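(* Let $\mathfrak{g}=\mathfrak{g}_1\oplus\dots\oplus\mathfrak{g}_N$ be a complex semisimple Lie algebra decomposed into its simple ideals, with Cartan subalgebra $\mathfrak{h}$, roots $\Phi\subset\mathfrak{h}^*$, base $\Delta$ for $\Phi$ and lattice of abstract weights $\tilde\Lambda$. Let $\mu\in\tilde\Lambda$ be an abstract weight such that $2\mu=(2k)\alpha+\beta$ for some elements $\alpha,\beta\in\Phi$ and some nonzero integer $k$. Then one of the following cases occurs: 1) There exists an integer $j$ with $1\leq j\leq N$ such that $\mu\in\tilde\Lambda_j$, $\alpha\in\Phi_j$ and $\beta\in\Phi_j$. 2) There exist distinct integers $i,j$ with $1\leq i,j\leq N$ such that a) $p_r(\mu)=0$ for $r\neq i$, $r\neq j$. b) The root $\alpha$ lies in $\Phi_i$, and $p_i(\mu)=k\alpha$. c) Either $\mathfrak{g}_j=A_1$ or $\mathfrak{g}_j=C_n$ for some integer $n\geq2$. In the first case $p_j(\mu)=\pm1$ (that is, $\pm\omega_1$). In the second case there exists an element $w_j\in W_j$ such that $w_j(p_j(\mu))=\omega_1$.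
   Context: $\mathfrak{h}=\mathfrak{h}_1\oplus\dots\oplus\mathfrak{h}_N$ with $\mathfrak{h}_i$ a Cartan subalgebra of $\mathfrak{g}_i$; $\mathfrak{h}^*=\mathrm{Hom}(\mathfrak{h},\mathbb{C})$ and $\mathfrak{h}_i^*=\mathrm{Hom}(\mathfrak{h}_i,\mathbb{C})$, the latter viewed as a subspace of $\mathfrak{h}^*$ by extending by zero on $\mathfrak{h}_j$, $j\neq i$, so $\mathfrak{h}^*=\mathfrak{h}_1^*\oplus\dots\oplus\mathfrak{h}_N^*$. $p_i:\mathfrak{h}^*\to\mathfrak{h}_i^*$ is restriction to $\mathfrak{h}_i$. $\Phi_i$, $W_i$ are the root system and Weyl group of $(\mathfrak{g}_i,\mathfrak{h}_i)$; $\Phi=\Phi_1\cup\dots\cup\Phi_N$; the base decomposes as $\Delta=\Delta_1\cup\dots\cup\Delta_N$ with $\Delta_i$ a base of $\Phi_i$. $\tilde\Lambda=\{\lambda\in\mathfrak{h}^*:\lambda(\tau_\alpha)\in\mathbb{Z}\ \forall\alpha\in\Phi\}$, where $\tau_\alpha=2H_\alpha/B(H_\alpha,H_\alpha)$, $B$ the Killing form, $B(H,H_\alpha)=\alpha(H)$; $\tilde\Lambda_i\subset\mathfrak{h}_i^*$ is defined similarly for $\mathfrak{g}_i$. $\omega_1$ denotes the first fundamental weight of $\mathfrak{g}_j$ relative to $\Delta_j$ in the standard (Bourbaki/Humphreys) numbering; for $C_n$, $2\omega_1$ is the highest long root. For $A_1$, weights are identified with integers by $m\leftrightarrow m\omega_1$.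 *)

(* Defs.v *)
From HB Require Import structures.
From mathcomp Require Import all_boot all_order all_algebra.
From mathcomp Require Import reals.
From mathcomp.real_closed Require Import complex.
Set Implicit Arguments.
Unset Strict Implicit.
Unset Printing Implicit Defensive.
Import Order.TTheory GRing.Theory Num.Theory.
Local Open Scope ring_scope.

(* Finite-dimensional Lie algebras: finiteness comes from [Vector]. *)
HB.mixin Record Vector_isLieAlgebra (K : fieldType) L of Vector K L := {
  lie : L -> L -> L;
  lie_linearl : forall (c : K) (x y z : L),
    lie (c *: x + y) z = c *: lie x z + lie y z;
  lie_linearr : forall (c : K) (x y z : L),
    lie x (c *: y + z) = c *: lie x y + lie x z;
  liexx : forall x : L, lie x x = 0;
  jacobi : forall x y z : L,
    lie x (lie y z) + lie y (lie z x) + lie z (lie x y) = 0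
}.

#[short(type="lieAlgType")]
HB.structure Definition LieAlgebra (K : fieldType) :=
  {L of Vector_isLieAlgebra K L & Vector K L}.

Section SubspacesOfLieAlgebras.
Variables (K : fieldType) (L : lieAlgType K).
Implicit Types (A I S h : {vspace L}) (x y : L).

(* [A, B]; by bilinearity brackets of basis vectors are enough *)
Definition lie_prod A B : {vspace L} :=
  <<[seq lie x y | x <- vbasis A, y <- vbasis B]>>%VS.

Definition is_ideal I := (lie_prod fullv I <= I)%VS.

Definition derived_series n A := iter n (fun B => lie_prod B B) A.

Definition solvable A := exists n, derived_series n A = 0%VS.

Definition semisimple := forall I, is_ideal I -> solvable I -> I = 0%VS.

(* The subalgebra S, as a Lie algebra in its own right, is simple. *)
Definition is_simple S :=
  lie_prod S S <> 0%VS /\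
  forall I, (I <= S)%VS -> (lie_prod S I <= I)%VS -> I = 0%VS \/ I = S.

Definition is_abelian A := lie_prod A A = 0%VS.

Definition ad x : 'End(L) := linfun (lie x).

Definition ad_diagonalizable x :=
  exists2 e : seq L, basis_of fullv e
    & forall v, v \in e -> exists c : K, lie x v = c *: v.

(* Cartan subalgebras of a complex semisimple Lie algebra: the maximal abelian
   subalgebras consisting of ad-semisimple elements (over an algebraically
   closed field, semisimple endomorphisms are the diagonalizable ones). *)
Definition is_cartan h :=
  [/\ is_abelian h,
      forall A, is_abelian A -> (h <= A)%VS -> A = h
    & forall x, x \in h -> ad_diagonalizable x].

Definition trace (f : 'End(L)) : K :=
  \sum_i coord (vbasis fullv) i (f (tnth (vbasis fullv) i)).

Definition killing x y : K := trace (ad x \o ad y)%VF.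

End SubspacesOfLieAlgebras.

(* h^* = Hom(h, K) *)
Notation dual h := ('Hom(subvs_of h, _^o)).

Section Roots.
Variables (K : fieldType) (L : lieAlgType K) (h : {vspace L}).
Notation hdual := 'Hom(subvs_of h, K^o).
Implicit Types (alpha beta gamma lambda mu : hdual) (H : subvs_of h).

(* as for [linfun], linear_form f agrees with f provided that f is linear *)
Definition linear_form (f : subvs_of h -> K) : hdual := @linfun K _ K^o f.

Definition is_root alpha :=
  alpha != 0 /\
  exists2 x : L, x != 0 & forall H, lie (vsval H) x = (alpha H : K) *: x.

Definition killing_map : 'Hom(subvs_of h, hdual) :=
  linfun (fun Y : subvs_of h =>
    linear_form (fun X => killing (vsval X) (vsval Y))).

(* H_alpha, with B(X, H_alpha) = alpha(X) for all X in h: the preimage of alpha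
   under h -> h^*, which is bijective when L is semisimple and h Cartan. *)
Definition H_ alpha : subvs_of h := (killing_map^-1)%VF alpha.

Definition tau alpha : subvs_of h :=
  (2%:R / killing (vsval (H_ alpha)) (vsval (H_ alpha))) *: H_ alpha.

Definition integral_on (P : hdual -> Prop) lambda :=
  forall alpha, P alpha -> exists m : int, lambda (tau alpha) = m%:~R.

Definition abstract_weight lambda := integral_on is_root lambda.

Definition reflection gamma lambda : hdual := lambda - (lambda (tau gamma) : K) *: gamma.

(* The group generated by the reflections in the elements of P; closure under
   inverses is automatic, reflections being involutions. *)
Inductive weyl_group (P : hdual -> Prop) : (hdual -> hdual) -> Prop :=
| weyl_id : weyl_group P id
| weyl_comp gamma w :
    P gamma -> weyl_group P w -> weyl_group P (reflection gamma \o w).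

(* Since Phi spans h^* and its real span is a real form of h^*, a basis of the
   real span of Phi consisting of roots is the same as a K-basis of h^*
   consisting of roots. *)
Definition is_base (Delta : seq hdual) :=
  [/\ basis_of fullv Delta,
      forall alpha, alpha \in Delta -> is_root alpha
    & forall beta, is_root beta -> exists c : 'I_(size Delta) -> nat,
        beta = \sum_(i < size Delta) Delta`_i *+ c i
        \/ beta = - \sum_(i < size Delta) Delta`_i *+ c i].

Section Components.
Variables (N : nat) (g_ : 'I_N -> {vspace L}).
Implicit Types j r : 'I_N.

(* h_j is h :&: g_ j; its dual is the space of forms on h vanishing on h_r for
   r != j. *)
Definition in_dual j lambda :=
  forall r H, r != j -> vsval H \in g_ r -> lambda H = 0.

(* Restriction to h_j followed by extension by zero: precomposition with the
   projection of h onto h_j, induced by that of L = \sum_i g_ i onto g_ j. *)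
Definition p_ j lambda : hdual :=
  linear_form (fun H => lambda (vsproj h (sumv_pi (\sum_i g_ i)%VS j (vsval H)))).

(* Phi_j: the roots of (g_j, h_j), extended by zero to h *)
Definition is_root_at j alpha :=
  [/\ in_dual j alpha, alpha != 0
    & exists2 x : L, x \in g_ j /\ x != 0
      & forall H, vsval H \in g_ j -> lie (vsval H) x = (alpha H : K) *: x].

(* For alpha in Phi_j, the coroot tau alpha is the same for L and for g_j,
   because the Killing form of L restricts to that of the ideal g_j and h_j is
   orthogonal to the other h_r. *)
Definition abstract_weight_at j lambda :=
  in_dual j lambda /\ integral_on (is_root_at j) lambda.

Definition weyl_group_at j := weyl_group (is_root_at j).

(* a_0, ..., a_(n-1) is a numbering of Delta_j with Cartan matrix A, the (i, k)
   entry being <a_i, a_k> = a_i(tau_(a_k)). *)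
Definition base_numbering (Delta : seq hdual) j n (A : 'M[int]_n)
    (a : n.-tuple hdual) :=
  [/\ uniq a,
      forall alpha, alpha \in a <-> alpha \in Delta /\ is_root_at j alpha
    & forall i k, (tnth a i) (tau (tnth a k)) = (A i k)%:~R].

Definition fundamental_weight j n (a : n.-tuple hdual) (i : 'I_n) omega :=
  in_dual j omega /\
  forall k, omega (tau (tnth a k)) = (k == i)%:R.

End Components.
End Roots.

Definition cartan_A1 : 'M[int]_1 := const_mx 2.

(* Type C_n, n >= 2, in the Bourbaki numbering shifted by one: index n - 1 is
   the long simple root, so only <a_(n-1), a_(n-2)> equals -2. *)
Definition cartan_C n : 'M[int]_n :=
  \matrix_(i, k)
    if i == k then 2
    else if ((i.+1 == k :> nat) || (k.+1 == i :> nat))%N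
      then if (i.+1 == n)%N then -2 else -1
    else 0.

(* Main.v *)
Require Import Defs.
From HB Require Import structures.
From mathcomp Require Import all_boot all_order all_algebra.
From mathcomp Require Import boolp reals.
From mathcomp Require Import zify ring.
From mathcomp.real_closed Require Import complex.
Set Implicit Arguments.
Unset Strict Implicit.
Unset Printing Implicit Defensive.
Import Order.TTheory GRing.Theory Num.Theory.
Local Open Scope ring_scope.

(** The roots alpha and beta lie in Phi_i and Phi_j for some i and j. If i = j,
    everything takes place in the dual of h_j. Otherwise k alpha vanishes at the
    coroots of g_j, so that mu_j = beta / 2, the component of mu along h_j, takes
    integral values there: it is half of a root and a weight
    (twice_weight_cases). It remains to see that such a weight exists only in
    types A_1 and C_n and that it is then conjugate to the first fundamental
    weight (half_root_component).

    In a root system Phi, call axis a vector e such that 2 e is a root and e takes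
    integral values at the coroots. If Phi is irreducible and has an axis, then by
    the usual bound on products of Cartan integers (axis_root), two axes are equal,
    opposite or orthogonal (axis_orthogonal), the difference of two distinct axes is
    a root (axes_linked), and each root is either the double of an axis or the
    difference of two orthogonal axes (root_axes). Hence Phi has type C_n, where n is
    the number of pairs of opposite axes, with C_1 = A_1. Given a base, list the
    positive axes ε_1, ..., ε_n by decreasing height: the ε_i - ε_(i+1) and 2 ε_n are
    the simple roots (simple_root_complete, simple_root_simple), ε_1 is the first
    fundamental weight, and the reflection in e - ε_1 maps any other axis e to ε_1
    (reflect_exchange).

    All this relies on the fact that the roots of (g_j, h_j) form an irreducible
    reduced root system, with integral Cartan numbers and a positive definite form
    (root_at_system). Since h is maximal abelian, it is its own centralizer, and the
    Killing form is the sum of the squares of the weights on h. The bracket of two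
    opposite weight vectors has trace zero on strings of weight spaces, so that the
    weights take proportional values there, with real ratios
    (weight_string_real). These two facts and the simplicity of the g_j imply that
    the Killing form is nondegenerate (killing_nondegenerate), without resort to the
    theorems of Engel and Lie. Representations of sl2 then give integrality,
    reflections and the fact that the double of a root is not a root (root_integral,
    root_double), and irreducibility comes from the simplicity of g_j
    (root_at_irreducible). *)

(** * Lie brackets, traces and the Killing form *)

Lemma linfunE_linear (K : fieldType) (U V : vectType K) (f : U -> V) :
  linear f -> linfun f =1 f.
Proof.
move=> lin_f; pose fZ := GRing.isLinear.Build K U V *:%R f lin_f.
pose f' : {linear U -> V} := HB.pack f fZ.
exact: (lfunE f').
Qed.

Lemma lfun_mulrz (K : fieldType) (V : vectType K) (f : 'Hom(V, K^o)) m v :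
  (f *~ m) v = m%:~R * f v :> K.
Proof. by rewrite -scaler_int scale_lfunE. Qed.

Lemma lfun_mulrn (K : fieldType) (V : vectType K) (f : 'Hom(V, K^o)) m v :
  (f *+ m) v = m%:R * f v :> K.
Proof. by rewrite -scaler_nat scale_lfunE. Qed.

Lemma lfunN (K : fieldType) (V : vectType K) (f : 'Hom(V, K^o)) v :
  f (- v) = - f v :> K.
Proof. by rewrite -scaleN1r linearZ /= scaleN1r. Qed.

Section LieAlgebraBasics.
Variables (K : fieldType) (L : lieAlgType K).
Implicit Types (x y z : L) (U V A B : {vspace L}).

Lemma lie0l z : lie 0 z = 0 :> L.
Proof.
apply: (addIr (lie 0 z)); have := lie_linearl 1 0 0 z.
by rewrite !scale1r add0r => <-; rewrite add0r.
Qed.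

Lemma lie0r z : lie z 0 = 0 :> L.
Proof.
apply: (addIr (lie z 0)); have := lie_linearr 1 z 0 0.
by rewrite !scale1r add0r => <-; rewrite add0r.
Qed.

Lemma lieDl x y z : lie (x + y) z = lie x z + lie y z.
Proof. by have := lie_linearl 1 x y z; rewrite !scale1r. Qed.

Lemma lieDr x y z : lie x (y + z) = lie x y + lie x z.
Proof. by have := lie_linearr 1 x y z; rewrite !scale1r. Qed.

Lemma lieZl c x z : lie (c *: x) z = c *: lie x z.
Proof. by have := lie_linearl c x 0 z; rewrite !addr0 lie0l addr0. Qed.

Lemma lieZr c x z : lie x (c *: z) = c *: lie x z.
Proof. by have := lie_linearr c x z 0; rewrite !addr0 lie0r addr0. Qed.

Lemma lieNl x z : lie (- x) z = - lie x z.
Proof. by rewrite -scaleN1r lieZl scaleN1r. Qed.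

Lemma lieNr x z : lie x (- z) = - lie x z.
Proof. by rewrite -scaleN1r lieZr scaleN1r. Qed.

Lemma lie_suml I (r : seq I) (P : pred I) (F : I -> L) z :
  lie (\sum_(i <- r | P i) F i) z = \sum_(i <- r | P i) lie (F i) z.
Proof. by apply: (big_morph (lie^~ z)) => [x y|]; rewrite ?lieDl ?lie0l. Qed.

Lemma lie_sumr I (r : seq I) (P : pred I) (F : I -> L) z :
  lie z (\sum_(i <- r | P i) F i) = \sum_(i <- r | P i) lie z (F i).
Proof. by apply: (big_morph (lie z)) => [x y|]; rewrite ?lieDr ?lie0r. Qed.

Lemma lieC x y : lie x y = - lie y x.
Proof.
apply/eqP; rewrite -addr_eq0; apply/eqP.
have := liexx (x + y); rewrite !lieDl !lieDr !liexx add0r addr0.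
by rewrite addrC => <-; rewrite addrC.
Qed.

Lemma lie_derivation x y z :
  lie x (lie y z) = lie (lie x y) z + lie y (lie x z).
Proof.
have := jacobi x y z; rewrite (lieC z (lie x y)) (lieC z x) lieNr => /eqP.
by rewrite -addrA -opprD subr_eq0 addrC => /eqP.
Qed.

Lemma lie_centralizer x y z :
  lie x z = 0 -> lie y z = 0 -> lie (lie x y) z = 0.
Proof.
move=> xz yz; have := lie_derivation x y z.
by rewrite xz yz !lie0r addr0 => <-.
Qed.

Lemma adE x y : ad x y = lie x y.
Proof.
by rewrite /ad linfunE_linear // => c u v; rewrite lieDr lieZr.
Qed.

Lemma lie_span X Y U :
    (forall x y, x \in X -> y \in Y -> lie x y \in U) ->
  forall x y, x \in <<X>>%VS -> y \in <<Y>>%VS -> lie x y \in U.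
Proof.
move=> XYU x y; rewrite -[X]in_tupleE -[Y]in_tupleE.
move=> /coord_span-> /coord_span->.
rewrite lie_suml memv_suml // => i _; rewrite lie_sumr memv_suml // => j _.
by rewrite lieZl lieZr !memvZ // XYU // mem_nth.
Qed.

Lemma lie_prodP A B U :
  reflect (forall x y, x \in A -> y \in B -> lie x y \in U)
          (lie_prod A B <= U)%VS.
Proof.
apply: (iffP span_subvP) => [AB x y Ax By | AB _ /allpairsP[[x y] /= [Ax By ->]]].
  rewrite -(span_basis (vbasisP A)) in Ax; rewrite -(span_basis (vbasisP B)) in By.
  apply: lie_span Ax By => u v Au Bv.
  by apply: AB; apply/allpairsP; exists (u, v).
by rewrite AB // vbasis_mem.
Qed.

Lemma mem_lie_prod A B x y : x \in A -> y \in B -> lie x y \in lie_prod A B.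
Proof. exact/lie_prodP. Qed.

Lemma is_abelianP A :
  (forall x y, x \in A -> y \in A -> lie x y = 0) <-> is_abelian A.
Proof.
split=> [A0 | A0 x y Ax Ay].
  apply/eqP; rewrite -subv0; apply/lie_prodP => x y Ax Ay.
  by rewrite A0 ?mem0v.
by apply/eqP; rewrite -memv0 -A0 mem_lie_prod.
Qed.

(** A central vector spans an abelian ideal. *)
Lemma semisimple_center0 z :
  semisimple L -> (forall x, lie z x = 0) -> z = 0.
Proof.
move=> ssL zC; apply/eqP; rewrite -memv0.
suff <-: <[z]>%VS = 0%VS by rewrite memv_line.
apply: ssL => [|].
  by apply/lie_prodP => x _ _ /vlineP[c ->]; rewrite lieZr lieC zC oppr0 scaler0 mem0v.
exists 1%N; apply/is_abelianP => _ _ /vlineP[c ->] /vlineP[d ->].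
by rewrite lieZl lieZr zC !scaler0.
Qed.

Section Trace.
Variables (n : nat) (e : n.-tuple L).
Hypothesis e_basis : basis_of fullv e.

Lemma coordE v : v = \sum_i coord e i v *: e`_i.
Proof. exact: coord_basis (memvf v). Qed.

Lemma traceE (f : 'End(L)) : trace f = \sum_i coord e i (f e`_i).
Proof.
rewrite /trace; set b := vbasis fullv.
under eq_bigr => i _ do
  rewrite [tnth b i]coordE linear_sum linear_sum /=.
rewrite exchange_big /=; apply: eq_bigr => j _.
rewrite [in RHS](coord_vbasis (memvf (f e`_j))) linear_sum /=.
by apply: eq_bigr => i _; rewrite !linearZ /= (tnth_nth 0) mulrC.
Qed.

(** Both sides expand to the same double sum over T of products of matrix
    entries, because the entries that lead out of T vanish. *)
Lemma partial_traceC (T : pred 'I_n) (f g : 'End(L)) :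
    (forall i j, T i -> ~~ T j -> coord e j (f e`_i) = 0) ->
    (forall i j, T i -> ~~ T j -> coord e j (g e`_i) = 0) ->
  \sum_(i | T i) coord e i (f (g e`_i)) = \sum_(i | T i) coord e i (g (f e`_i)).
Proof.
have expand (f1 g1 : 'End(L)) :
    (forall i j, T i -> ~~ T j -> coord e j (g1 e`_i) = 0) ->
    \sum_(i | T i) coord e i (f1 (g1 e`_i)) =
    \sum_(i | T i) \sum_(j | T j) coord e i (f1 e`_j) * coord e j (g1 e`_i).
  move=> Tg; apply: eq_bigr => i Ti.
  rewrite {1}[g1 e`_i]coordE !linear_sum (bigID T) /= addrC big1 ?add0r.
    by apply: eq_bigr => j Tj; rewrite !linearZ mulrC.
  by move=> j Tj; rewrite Tg // scale0r !linear0.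
move=> Tf Tg; rewrite !expand // exchange_big.
by apply: eq_bigr => i _; apply: eq_bigr => j _; rewrite mulrC.
Qed.

End Trace.

Lemma traceC (f g : 'End(L)) : trace (f \o g)%VF = trace (g \o f)%VF.
Proof.
rewrite !(traceE (vbasisP fullv)).
under eq_bigr => i _ do rewrite comp_lfunE.
under [RHS]eq_bigr => i _ do rewrite comp_lfunE.
by rewrite (partial_traceC (vbasisP fullv) (T := predT)).
Qed.

Lemma trace_linear : linear (@trace K L : 'End(L) -> K^o).
Proof.
move=> c f g; rewrite /trace scaler_sumr -big_split /=.
by apply: eq_bigr => i _; rewrite add_lfunE scale_lfunE linearP.
Qed.

Lemma killingC x y : killing x y = killing y x.
Proof. exact: traceC. Qed.

Lemma ad_linear : linear (@ad K L).
Proof.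
move=> c x y; apply/lfunP => z; rewrite add_lfunE scale_lfunE.
by rewrite !adE lieDl lieZl.
Qed.

Lemma killing_linearl y : linear (fun x => killing x y : K^o).
Proof.
move=> c u v; rewrite /killing ad_linear comp_lfunDl -comp_lfunZl.
exact: trace_linear.
Qed.

Lemma killingDl x y z : killing (x + y) z = killing x z + killing y z.
Proof. by have := killing_linearl z 1 x y; rewrite !scale1r. Qed.

Lemma killing0l x : killing 0 x = 0.
Proof. by apply: (addIr (killing 0 x)); rewrite -killingDl !add0r. Qed.

Lemma killingZl c x y : killing (c *: x) y = c * killing x y.
Proof.
by have := killing_linearl y c x 0; rewrite !addr0 => ->; rewrite killing0l addr0.
Qed.

Lemma killingZr c x y : killing x (c *: y) = c * killing x y.
Proof. by rewrite !(killingC x) killingZl. Qed.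

Lemma killing0r x : killing x 0 = 0.
Proof. by rewrite killingC killing0l. Qed.

Lemma killing_linearr y : linear (killing y : L -> K^o).
Proof. by move=> c u v; rewrite !(killingC y); apply: killing_linearl. Qed.

(** ad turns brackets into commutators, and the trace is cyclic. *)
Lemma killing_invariant x y z : killing (lie x y) z = killing x (lie y z).
Proof.
have ad_lie (u v : L) : ad (lie u v) = ((ad u \o ad v) - (ad v \o ad u))%VF.
  apply/lfunP => w; rewrite add_lfunE opp_lfunE !comp_lfunE !adE.
  by rewrite (lie_derivation u v w) addrK.
have traceB (f g : 'End(L)) : trace (f - g) = trace f - trace g :> K.
  by rewrite addrC -scaleN1r trace_linear scaleN1r addrC.
rewrite /killing !ad_lie comp_lfunDl comp_lfunDr comp_lfunNl comp_lfunNr.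
by rewrite !traceB -!comp_lfunA (traceC (ad y)) -comp_lfunA.
Qed.

End LieAlgebraBasics.

(** * Weight vectors for a Cartan subalgebra *)

Section Weights.
Variables (K : fieldType) (L : lieAlgType K) (h : {vspace L}).
Notation hdual := 'Hom(subvs_of h, K^o).
Implicit Types (x y z u v : L) (U V : {vspace L}) (lam mu : hdual).
Implicit Types (H : subvs_of h).

Definition weight_vector lam x :=
  forall H, lie (vsval H) x = (lam H : K) *: x.

Definition cartan_stable U :=
  forall z x, z \in h -> x \in U -> lie z x \in U.

Lemma weight_vectorZ lam c x :
  weight_vector lam x -> weight_vector lam (c *: x).
Proof. by move=> wx H; rewrite lieZr wx !scalerA mulrC. Qed.

Lemma weight_vector_lie lam mu x y :
    weight_vector lam x -> weight_vector mu y ->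
  weight_vector (lam + mu) (lie x y).
Proof.
move=> wx wy H; rewrite lie_derivation wx wy lieZl lieZr -scalerDl.
by rewrite add_lfunE.
Qed.

(** Applying z - a kills the component of eigenvalue a and rescales the other
    ones by nonzero factors, so one can argue by induction on their number. *)
Lemma stable_eigen_components z U (s : seq (K * L)) :
    (forall u, u \in U -> lie z u \in U) ->
    uniq (unzip1 s) ->
    (forall p, p \in s -> lie z p.2 = p.1 *: p.2) ->
    \sum_(p <- s) p.2 \in U ->
  forall p, p \in s -> p.2 \in U.
Proof.
move=> Uz; have [n le_sn] := ubnP (size s).
elim: n s le_sn => // n IHn [|[a v] s] //= le_sn /andP[a's uniq_s] eig.
rewrite big_cons /= => Usum.
have eig_s p : p \in s -> lie z p.2 = p.1 *: p.2.
  by move=> sp; apply: eig; rewrite inE sp orbT.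
have Us p : p \in s -> p.2 \in U.
  move=> sp; pose s' := [seq (q.1, (q.1 - a) *: q.2) | q <- s].
  have s'U q : q \in s' -> q.2 \in U.
    apply: IHn; first by rewrite size_map.
    - by rewrite /unzip1 -map_comp (eq_map (_ : _ =1 fst)).
    - by move=> _ /mapP[r sr ->] /=; rewrite lieZr eig_s // !scalerA mulrC.
    rewrite big_map /=.
    suff ->: \sum_(q <- s) (q.1 - a) *: q.2 =
             lie z (v + \sum_(q <- s) q.2) - a *: (v + \sum_(q <- s) q.2).
      by rewrite memvB ?memvZ ?Uz.
    have /= zv := eig (a, v) (mem_head _ _).
    rewrite lieDr zv scalerDr lie_sumr opprD addrACA subrr add0r scaler_sumr -sumrB.
    by rewrite !big_seq; apply: eq_bigr => r sr; rewrite scalerBl eig_s.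
  have /s'U /=: (p.1, (p.1 - a) *: p.2) \in s' by apply/mapP; exists p.
  rewrite rpredZeq subr_eq0 => /orP[/eqP p1a|//].
  by case/negP: a's; rewrite -p1a; apply/mapP; exists p.
have Us_sum : \sum_(q <- s) q.2 \in U by rewrite big_seq memv_suml.
move=> p; rewrite inE => /orP[/eqP-> /=|/Us//].
by rewrite -(addrK (\sum_(q <- s) q.2) v) memvB.
Qed.

Lemma stable_eigen_sum z U u :
    ad_diagonalizable z -> (forall u, u \in U -> lie z u \in U) -> u \in U ->
  exists2 t : seq L, u = \sum_(v <- t) v
    & forall v, v \in t -> v \in U /\ exists c, lie z v = c *: v.
Proof.
case=> e e_basis eig Uz Uu; pose b := in_tuple e.
have /fin_all_exists[c cP] (i : 'I_(size e)) : exists c, lie z e`_i = c *: e`_i.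
  by apply: eig; rewrite mem_nth.
pose part a := \sum_(i | c i == a) coord b i u *: e`_i.
pose s := [seq (a, part a) | a <- undup (codom c)].
have s1 : unzip1 s = undup (codom c).
  by rewrite /unzip1 -map_comp -[RHS]map_id; apply: eq_map => a.
have s_eig p : p \in s -> lie z p.2 = p.1 *: p.2.
  case/mapP=> a _ -> /=; rewrite lie_sumr scaler_sumr.
  by apply: eq_bigr => i /eqP <-; rewrite lieZr cP !scalerA mulrC.
have u_sum : u = \sum_(p <- s) p.2.
  rewrite big_map /= (exchange_big_dep predT) //= {1}[u](coordE (e := b)) //.
  apply: eq_bigr => i _; rewrite big_mkcond (bigD1_seq (c i)) ?undup_uniq //=;
    last by rewrite mem_undup codom_f.
  rewrite eqxx big1 ?addr0 // => a a_ci.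
  by rewrite eq_sym (negPf a_ci).
exists [seq p.2 | p <- s]; first by rewrite big_map.
move=> _ /mapP[p sp ->]; split; last by exists p.1; apply: s_eig.
by apply: (stable_eigen_components Uz _ s_eig _ sp); rewrite ?s1 ?undup_uniq -?u_sum.
Qed.

Hypothesis h_cartan : is_cartan h.

Lemma cartan_commutes x y : x \in h -> y \in h -> lie x y = 0.
Proof. by case: h_cartan => hh _ _; apply: (proj2 (is_abelianP h)). Qed.

(** Together with h, such an x spans an abelian subalgebra. *)
Lemma cartan_centralizer x : (forall y, y \in h -> lie y x = 0) -> x \in h.
Proof.
case: h_cartan => hh h_max _ hx.
suff <-: (h + <[x]>)%VS = h by rewrite memvE addvSr.
apply: h_max; last exact: addvSl.
apply/is_abelianP => _ _ /memv_addP[y hy [_ /vlineP[c ->] ->]]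
  /memv_addP[z hz [_ /vlineP[d ->] ->]].
rewrite !lieDl !lieDr !lieZl !lieZr liexx (lieC x) (hx _ hy) (hx _ hz).
by rewrite cartan_commutes // oppr0 !scaler0 !addr0.
Qed.

(** Commuting operators preserve each other's eigenspaces, so the elements of X
    can be diagonalized one after the other, each inside the intersection of U
    with an eigenspace of the previous one. *)
Lemma cartan_stable_eigen_sum (X : seq L) U u :
    {subset X <= h} -> cartan_stable U -> u \in U ->
  exists2 t : seq L, u = \sum_(v <- t) v
    & forall v, v \in t -> v \in U /\
        forall z, z \in X -> exists c, lie z v = c *: v.
Proof.
elim: X U u => [|z X IHX] U u Xh Uh Uu.
  by exists [:: u]; rewrite ?big_seq1 // => v; rewrite inE => /eqP->.
have hz : z \in h by rewrite Xh ?mem_head.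
have diag_z : ad_diagonalizable z by case: h_cartan => _ _; apply.
have [t -> tP] := stable_eigen_sum diag_z (fun u => @Uh z u hz) Uu.
elim: t tP => [|v t IHt] tP; first by exists [::].
have [Uv [c zv]] := tP v (mem_head _ _).
rewrite big_cons; have [w tw|t1 -> t1P] := IHt.
  by apply: tP; rewrite inE tw orbT.
have ker_linear : linear (fun w => lie z w - c *: w).
  move=> d w1 w2; rewrite lieDr lieZr scalerDr opprD.
  by rewrite addrACA scalerBr !scalerA mulrC.
pose Uc := (U :&: lker (linfun (fun w => lie z w - c *: w)))%VS.
have UcE w : (w \in Uc) = (w \in U) && (lie z w == c *: w).
  by rewrite memv_cap memv_ker linfunE_linear // subr_eq0.
have [|||t2 -> t2P] := IHX Uc v.
- by move=> w Xw; rewrite Xh // inE Xw orbT.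
- move=> y w hy; rewrite !UcE => /andP[Uw /eqP zw]; rewrite Uh //=.
  by rewrite lie_derivation (cartan_commutes hz hy) lie0l add0r zw lieZr.
- by rewrite UcE Uv zv eqxx.
exists (t2 ++ t1) => [|w]; first by rewrite big_cat.
rewrite mem_cat => /orP[|/t1P//] /t2P[]; rewrite UcE => /andP[Uw /eqP zw] Xw.
by split=> // y; rewrite inE => /orP[/eqP->|/Xw//]; exists c.
Qed.

Lemma linear_formE (f : subvs_of h -> K) :
  linear (f : subvs_of h -> K^o) -> forall H, linear_form f H = f H.
Proof. by move=> lin_f H; rewrite /linear_form linfunE_linear. Qed.

(** It suffices to diagonalize a basis of h, since the eigenvalue of a common
    eigenvector depends linearly on the element of h. *)
Lemma weight_decomposition U u : cartan_stable U -> u \in U ->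
  exists2 t : seq L, u = \sum_(v <- t) v
    & forall v, v \in t -> v \in U /\ exists lam, weight_vector lam v.
Proof.
move=> Uh Uu.
have [t -> tP] := cartan_stable_eigen_sum (@vbasis_mem _ _ ^~ h) Uh Uu.
exists t => // v tv; have [Uv eig] := tP v tv; split=> //.
have [-> | v0] := eqVneq v 0; first by exists 0 => H; rewrite lie0r scaler0.
have {}eig z : z \in h -> exists c, lie z v = c *: v.
  move=> hz; rewrite (coord_vbasis hz) lie_suml.
  have /fin_all_exists[c cP] (i : 'I_(\dim h)) :
      exists c, lie (vbasis h)`_i v = c *: v.
    by apply: eig; rewrite mem_nth ?size_tuple.
  exists (\sum_i coord (vbasis h) i z * c i).
  by rewrite scaler_suml; apply: eq_bigr => i _; rewrite lieZl cP scalerA.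
(* A coordinate in which v does not vanish reads off the eigenvalue. *)
have [i vi] : exists i, coord (vbasis fullv) i v != 0.
  apply/existsP; apply: contraNT v0 => /existsPn v0.
  rewrite (coord_vbasis (memvf v)) big1 // => i _.
  by move/negbNE/eqP: (v0 i) => ->; rewrite scale0r.
pose f H := coord (vbasis fullv) i (lie (vsval H) v) / coord (vbasis fullv) i v.
have lin_f : linear (f : subvs_of h -> K^o).
  move=> c x y; rewrite /f linearP lieDl lieZl linearP mulrDl.
  by rewrite -mulrA.
exists (linear_form f) => H; rewrite linear_formE // /f.
by have [c ->] := eig _ (subvsP H); rewrite linearZ /= mulfK.
Qed.

Lemma free_subseq_span (s : seq L) :
  exists t : seq L, [/\ {subset t <= s}, free t & <<t>>%VS = <<s>>%VS].
Proof.
elim: s => [|x s [t [ts free_t span_t]]]; first by exists [::]; rewrite nil_free.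
have [tx | t'x] := boolP (x \in <<t>>%VS).
  exists t; split=> // [y /ts ys|]; first by rewrite inE ys orbT.
  by rewrite span_cons -span_t; apply/esym/addv_idPr; rewrite -memvE.
exists (x :: t); rewrite free_cons t'x !span_cons span_t; split=> // y.
by rewrite !inE => /orP[->//|/ts->]; rewrite orbT.
Qed.

Lemma weight_basis : exists n (e : n.-tuple L) (wt : 'I_n -> hdual),
  basis_of fullv e /\ forall i, weight_vector (wt i) e`_i.
Proof.
have [s sP spans] : exists2 s : seq L,
    forall v, v \in s -> exists lam, weight_vector lam v & <<s>>%VS = fullv.
  suff [s sP sS] : exists2 s : seq L,
      forall v, v \in s -> exists lam, weight_vector lam v
      & {subset (vbasis {:L} : seq L) <= <<s>>%VS}.
    exists s => //; apply/eqP; rewrite eqEsubv subvf /=.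
    by rewrite -(span_basis (vbasisP fullv)); apply/span_subvP.
  elim: (vbasis _ : seq L) => [|u b [s sP sS]]; first by exists [::].
  have [//|t -> tP] := @weight_decomposition fullv u _ (memvf u).
    by move=> *; apply: memvf.
  exists (t ++ s) => [v|v]; first by rewrite mem_cat => /orP[/tP[]|/sP].
  rewrite inE span_cat => /orP[/eqP->|/sS sv].
    by apply: subvP (addvSl _ _) _ _; rewrite big_seq memv_suml // => w; exact: memv_span.
  exact: subvP (addvSr _ _) _ sv.
have [t [ts free_t span_t]] := free_subseq_span s.
have /fin_all_exists[wt wtP] (i : 'I_(size t)) :
    exists lam, weight_vector lam t`_i.
  by apply: sP; rewrite ts ?mem_nth.
exists (size t), (in_tuple t), wt; split=> //.
by rewrite /basis_of free_t span_t spans eqxx.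
Qed.

End Weights.

(** * Axes of an irreducible root system *)

Lemma int_factor_cases (m k : int) : m * k = 1 \/ m * k = 2 ->
  m = -2 \/ m = -1 \/ m = 1 \/ m = 2.
Proof.
move=> mk; have k0 : k != 0.
  by apply/eqP => k0; move: mk; rewrite k0 mulr0; lia.
have le_m : (`|m| <= `|(m * k)%R|)%N by rewrite abszM leq_pmulr // absz_gt0.
have [m0|m0] := eqVneq m 0; first by move: mk; rewrite m0 mul0r; lia.
by move: le_m; case: mk => -> /=; lia.
Qed.

Section RootSystem.
Variables (K : numFieldType) (V : lmodType K).
Implicit Types (B : V -> V -> K) (Phi : V -> Prop).

Definition reflect_by B delta gamma :=
  gamma - (2%:R * B gamma delta / B delta delta) *: delta.

(** The roots may span V over the complex numbers, where B is not positive
    definite; definiteness on their rational span is needed only for pairs of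
    roots, in the form of the Cauchy-Schwarz inequality with its case of equality. *)
Record irreducible_root_system B Phi : Prop := IrreducibleRootSystem {
  rs_sym : forall u v, B u v = B v u;
  rs_linear : forall c u v w, B (c *: u + v) w = c * B u w + B v w;
  rs_pos : forall gamma, Phi gamma -> 0 < B gamma gamma;
  rs_CauchySchwarz : forall gamma delta, Phi gamma -> Phi delta ->
    B gamma delta ^+ 2 < B gamma gamma * B delta delta \/
    exists c, delta = c *: gamma;
  rs_int : forall gamma delta, Phi gamma -> Phi delta ->
    exists z : int, 2%:R * B gamma delta / B delta delta = z%:~R;
  rs_reflect : forall gamma delta, Phi gamma -> Phi delta ->
    Phi (reflect_by B delta gamma);
  rs_double : forall gamma, Phi gamma -> ~ Phi (gamma *+ 2);
  rs_irreducible : forall (P : V -> Prop) gamma0, Phi gamma0 -> P gamma0 ->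
    (forall gamma delta, Phi gamma -> Phi delta -> P gamma -> ~ P delta ->
       B gamma delta = 0) ->
    forall delta, Phi delta -> P delta
}.

End RootSystem.

Section Axes.
Variables (K : numFieldType) (V : lmodType K) (B : V -> V -> K).
Variable Phi : V -> Prop.
Implicit Types (u v w e f m : V) (gamma delta : V).

Hypothesis Phi_rs : irreducible_root_system B Phi.

Let B_sym := rs_sym Phi_rs.
Let B_lin := rs_linear Phi_rs.
Let Phi_pos := rs_pos Phi_rs.
Let Phi_CauchySchwarz := rs_CauchySchwarz Phi_rs.
Let Phi_int := rs_int Phi_rs.
Let Phi_reflect := rs_reflect Phi_rs.
Let Phi_double := rs_double Phi_rs.
Let Phi_irreducible := rs_irreducible Phi_rs.

Local Notation reflect_by := (reflect_by B).

(** In type C_n, with the roots ±ε_i ± ε_k and ±2 ε_i, the axes are the ±ε_i; in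
    type A_1, they are the two halves of the roots. *)
Definition axis e := Phi (e *+ 2) /\
  forall gamma, Phi gamma ->
    exists z : int, 2%:R * B e gamma / B gamma gamma = z%:~R.

Let BDl u v w : B (u + v) w = B u w + B v w.
Proof. by have := B_lin 1 u v w; rewrite scale1r mul1r. Qed.

Let B0l w : B 0 w = 0.
Proof. by apply: (addIr (B 0 w)); rewrite -BDl !add0r. Qed.

Let BZl c u w : B (c *: u) w = c * B u w.
Proof. by have := B_lin c u 0 w; rewrite !addr0 B0l addr0. Qed.

Let BNl u w : B (- u) w = - B u w.
Proof. by rewrite -scaleN1r BZl mulN1r. Qed.

Let BMnl u w k : B (u *+ k) w = k%:R * B u w.
Proof. by rewrite -scaler_nat BZl. Qed.

Let BDr u v w : B w (u + v) = B w u + B w v.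
Proof. by rewrite !(B_sym w) BDl. Qed.

Let BZr c u w : B w (c *: u) = c * B w u.
Proof. by rewrite !(B_sym w) BZl. Qed.

Let BNr u w : B w (- u) = - B w u.
Proof. by rewrite !(B_sym w) BNl. Qed.

Let BMnr u w k : B w (u *+ k) = k%:R * B w u.
Proof. by rewrite !(B_sym w) BMnl. Qed.

Let BE := (BDl, BDr, BZl, BZr, BNl, BNr, BMnl, BMnr).

Lemma Phi_neq0 gamma : Phi gamma -> B gamma gamma != 0.
Proof. by move/Phi_pos/lt0r_neq0. Qed.

Lemma Phi_opp gamma : Phi gamma -> Phi (- gamma).
Proof.
move=> Pg; have := Phi_reflect Pg Pg; rewrite /reflect_by mulfK ?Phi_neq0 //.
by rewrite scaler_nat mulr2n opprD addNKr.
Qed.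

Lemma axis_pos e : axis e -> 0 < B e e.
Proof.
case=> /Phi_pos; rewrite !BE mulrA -natrM pmulr_rgt0 ?ltr0n //.
Qed.

Lemma axis_opp e : axis e -> axis (- e).
Proof.
case=> P2e e_int; split=> [|gamma Pg]; first by rewrite mulNrn; apply: Phi_opp.
have [z zE] := e_int gamma Pg; exists (- z).
by rewrite BNl mulrN mulNr zE mulrNz.
Qed.

(** The integers m = 2 (e, gamma) / (gamma, gamma) and k = (e, gamma) / (e, e)
    satisfy m k <= 2 by Cauchy-Schwarz. If m k = 1, both are 1 or both are -1. If
    m k = 2, then gamma is a multiple of e; the multiples ±e are excluded because
    the root ±2 e would be the double of a root. *)
Lemma axis_root e gamma : axis e -> Phi gamma -> B e gamma != 0 ->
  [\/ gamma = e *+ 2, gamma = - (e *+ 2)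
    | B gamma gamma = 2%:R * B e e /\
      (2%:R * B e gamma = B gamma gamma \/ 2%:R * B e gamma = - B gamma gamma)].
Proof.
move=> ax_e Pg eg0; have [P2e e_int] := ax_e.
have ee_gt0 := axis_pos ax_e; have gg_gt0 := Phi_pos Pg.
have ee0 := lt0r_neq0 ee_gt0; have gg0 := lt0r_neq0 gg_gt0.
have [m mE] := e_int _ Pg; have [k kE] := Phi_int Pg P2e.
have {}mE : 2%:R * B e gamma = m%:~R * B gamma gamma by rewrite -mE mulfVK.
have {}kE : B e gamma = k%:~R * B e e.
  by rewrite -kE !BE (B_sym gamma); field.
have mkE : (m * k)%:~R * (B gamma gamma * B e e) = 2%:R * B e gamma ^+ 2.
  transitivity ((m%:~R * B gamma gamma) * (k%:~R * B e e)); first by rewrite intrM; ring.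
  by rewrite -mE -kE; ring.
have eg_real : B e gamma \is Num.real.
  by rewrite kE rpredM ?rpred_int ?gtr0_real.
have eg2_gt0 : 0 < B e gamma ^+ 2 by rewrite real_exprn_even_gt0.
have gge_gt0 : 0 < B gamma gamma * B e e by rewrite mulr_gt0.
have mk_gt0 : 0 < m * k.
  by rewrite -(ltr0z K) -(pmulr_lgt0 _ gge_gt0) mkE mulr_gt0 ?ltr0n.
have [|[c cE]] := Phi_CauchySchwarz Pg P2e.
  rewrite !BE (B_sym gamma) => CS.
  have mk_lt2 : m * k < 2.
    rewrite -(ltr_int K) -(ltr_pM2r gge_gt0) mkE ltr_pM2l ?ltr0n //.
    rewrite -(ltr_pM2l (_ : 0 < 4%:R)) ?ltr0n //.
    have -> : 4%:R * B e gamma ^+ 2 = (2%:R * B e gamma) ^+ 2 by ring.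
    by have <- : B gamma gamma * (2%:R * (2%:R * B e e)) =
                 4%:R * (B gamma gamma * B e e) by ring.
  have mk1 : m * k = 1 by lia.
  have [[m1 k1]|[m1 k1]] : (m = 1 /\ k = 1) \/ (m = -1 /\ k = -1).
    by case: (int_factor_cases (or_introl mk1)) => [|[|[|]]] m_val;
      move: mk1; rewrite m_val; lia.
    apply: Or33; move: mE kE; rewrite m1 k1 !mul1r => mE kE.
    by split; [rewrite -mE kE | left].
  apply: Or33; move: mE kE; rewrite m1 k1 !mulN1r => mE kE.
  by split; [apply: oppr_inj; rewrite -mE kE mulrN | right].
have cm : c = m%:~R.
  by apply: (mulIf gg0); rewrite -mE -BZl -cE BMnl.
have mk2 : m * k = 2.
  apply: (@intr_inj K); apply: (mulIf (mulf_neq0 gg0 ee0)).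
  rewrite mkE; apply: (mulfI (_ : 2%:R != 0)); first by rewrite pnatr_eq0.
  have ee4 : 4%:R * B e e = c * c * B gamma gamma.
    by rewrite -mulrA -BZr -BZl -cE !BE mulrA -natrM.
  transitivity ((2%:R * B e gamma) * (2%:R * B e gamma)); first by ring.
  rewrite mE -cm; transitivity ((c * c * B gamma gamma) * B gamma gamma); first by ring.
  by rewrite -ee4; ring.
have [] : [\/ m = 1, m = -1, m = 2 | m = -2].
  by have [|[|[]]] := int_factor_cases (or_intror mk2); [constructor 4
    | constructor 2 | constructor 1 | constructor 3].
all: move=> m_val; move: cE; rewrite cm m_val.
- by rewrite scale1r => ->; constructor 1.
- by rewrite scaleN1r => ->; rewrite opprK; constructor 2.
- by rewrite scaler_int => e2; case: (Phi_double Pg); rewrite [gamma *+ 2]pmulrn -e2.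
rewrite scaler_int => e2; case: (Phi_double (Phi_opp Pg)).
by rewrite mulNrn pmulrn -mulrNz -e2.
Qed.

Lemma double_inj u v : u *+ 2 = v *+ 2 -> u = v.
Proof.
move/eqP; rewrite -!scaler_nat -subr_eq0 -scalerBr scaler_eq0 pnatr_eq0 /=.
by rewrite subr_eq0 => /eqP.
Qed.

(** Otherwise axis_root, applied to the roots 2 f and 2 e, shows that each of
    (e, e) and (f, f) is twice the other. *)
Lemma axis_orthogonal e f : axis e -> axis f -> [\/ e = f, e = - f | B e f = 0].
Proof.
move=> ax_e ax_f; have [ef0|ef0] := eqVneq (B e f) 0; first by constructor 3.
have [P2e _] := ax_e; have [P2f _] := ax_f.
have ef2 : B e (f *+ 2) != 0 by rewrite BMnr mulf_neq0 ?pnatr_eq0.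
have fe2 : B f (e *+ 2) != 0 by rewrite BMnr B_sym mulf_neq0 ?pnatr_eq0.
have [/double_inj->|f2e|[ffee _]] := axis_root ax_e P2f ef2.
- by constructor 1.
- by constructor 2; apply: double_inj; rewrite mulNrn f2e opprK.
have [/double_inj->|e2f|[eeff _]] := axis_root ax_f P2e fe2.
- by constructor 1.
- by constructor 2; apply: double_inj; rewrite e2f mulNrn.
move: ffee eeff; rewrite !BE => ffee eeff.
have n2 : (2%:R : K) != 0 by rewrite pnatr_eq0.
have e_eq : B e e = 4%:R * B e e.
  by apply: (mulfI n2); rewrite -{1}ffee -eeff; ring.
have /eqP : 3%:R * B e e = 0 by apply: (addIr (B e e)); rewrite add0r {3}e_eq; ring.
by rewrite mulf_eq0 pnatr_eq0 (negPf (lt0r_neq0 (axis_pos ax_e))).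
Qed.

Lemma reflect_adjoint gamma u v :
  B (reflect_by gamma u) v = B u (reflect_by gamma v).
Proof. by rewrite /reflect_by !BE (B_sym gamma v); ring. Qed.

Lemma reflect_isometry gamma u v : B gamma gamma != 0 ->
  B (reflect_by gamma u) (reflect_by gamma v) = B u v.
Proof.
by move=> gg0; rewrite /reflect_by !BE (B_sym gamma v); field.
Qed.

Lemma axis_reflect e gamma : axis e -> Phi gamma -> axis (reflect_by gamma e).
Proof.
move=> [P2e e_int] Pg; have gg0 := Phi_neq0 Pg; split=> [|delta Pd].
  have <- : reflect_by gamma (e *+ 2) = reflect_by gamma e *+ 2.
    by rewrite /reflect_by mulrnBl BMnl scalerMnl -[(_ / _) *+ 2]mulr_natl !mulrA.
  exact: Phi_reflect.
have [z zE] := e_int _ (Phi_reflect Pd Pg); exists z; rewrite -zE.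
by rewrite reflect_isometry // reflect_adjoint.
Qed.

(** Opposite axes are linked, because their difference is a root. *)
Definition linked e f := e = f \/ Phi (e - f).

Lemma axis_norm_neq0 e : axis e -> B e e != 0.
Proof. by move/axis_pos/lt0r_neq0. Qed.

(** In the main case, reflecting in f - m exchanges the axes f and m. *)
Lemma linked_trans e f m : axis e -> axis f -> axis m ->
  linked e f -> linked f m -> linked e m.
Proof.
move=> ax_e ax_f ax_m [->//|Pef] [<-|Pfm]; first by right.
have [P2e _] := ax_e; have [P2f _] := ax_f.
have ff0 := axis_norm_neq0 ax_f; have mm0 := axis_norm_neq0 ax_m.
have reflect_eq u v w c : 2%:R * B u v = c * B v v -> B v v != 0 ->
    u - c *: v = w -> Phi u -> Phi v -> Phi w.
  move=> uv vv0 <- Pu Pv; have := Phi_reflect Pu Pv.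
  by rewrite /reflect_by uv mulfK.
have [ef|ef|ef0] := axis_orthogonal ax_e ax_f; first by right; rewrite ef.
  have [fm|fm|fm0] := axis_orthogonal ax_f ax_m; first by right; rewrite -fm.
    by left; rewrite ef fm opprK.
  right; apply: (reflect_eq (f - m) (f *+ 2) _ 1) => //; last 2 first.
  - exact: Phi_neq0.
  - by rewrite ef scale1r mulr2n opprD addrACA subrr add0r addrC.
  by rewrite !BE (B_sym m) fm0; ring.
have [fm|fm|fm0] := axis_orthogonal ax_f ax_m; first by right; rewrite -fm.
  right; apply: (reflect_eq (e - f) (f *+ 2) _ (-1)) => //; last 2 first.
  - exact: Phi_neq0.
  - by rewrite scaleN1r opprK mulr2n addrA addrNK fm.
  by rewrite !BE ef0; ring.
have [em|em|em0] := axis_orthogonal ax_e ax_m; first by left.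
  by right; rewrite -[m]opprK -em opprK -mulr2n.
have Bfm : B f (f - m) != 0 by rewrite !BE fm0 subr0.
have norm_fm : B (f - m) (f - m) = 2%:R * B f f.
  have [fm_eq|fm_eq|[]//] := axis_root ax_f Pfm Bfm.
    have /eqP := congr1 (B m) fm_eq; rewrite !BE (B_sym m f) fm0 mulr0 add0r.
    by rewrite oppr_eq0 (negPf mm0).
  have /eqP := congr1 (B m) fm_eq; rewrite !BE (B_sym m f) fm0 mulr0 add0r oppr0.
  by rewrite oppr_eq0 (negPf mm0).
right; apply: (reflect_eq (e - f) (f - m) _ (-1)) => //.
- by rewrite norm_fm !BE ef0 em0 fm0; ring.
- exact: Phi_neq0.
by rewrite scaleN1r opprK addrA addrNK.
Qed.

(** For orthogonal axes, (e - f, e - f) is (e, e) + (f, f), and axis_root says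
    that it is 2 (e, e). *)
Lemma linked_norm e f : axis e -> axis f -> linked e f -> B e e = B f f.
Proof.
move=> ax_e ax_f [->//|Pef].
have [->//|->|ef0] := axis_orthogonal ax_e ax_f; first by rewrite !BE opprK.
have Be : B e (e - f) != 0 by rewrite !BE ef0 subr0 axis_norm_neq0.
have [e_eq|e_eq|[]] := axis_root ax_e Pef Be.
- have /eqP := congr1 (B f) e_eq; rewrite !BE (B_sym f e) ef0 mulr0 add0r.
  by rewrite oppr_eq0 (negPf (axis_norm_neq0 ax_f)).
- have /eqP := congr1 (B f) e_eq; rewrite !BE (B_sym f e) ef0 mulr0 add0r oppr0.
  by rewrite oppr_eq0 (negPf (axis_norm_neq0 ax_f)).
move=> norm_ef _; apply: (addrI (B e e)).
transitivity (B (e - f) (e - f)); first by rewrite norm_ef; ring.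
by rewrite !BE (B_sym f e) ef0; ring.
Qed.

Section Connected.
Variable e0 : V.
Hypothesis ax_e0 : axis e0.

(** A root that is not orthogonal to some axis linked to e0 is a combination of
    such axes, hence orthogonal to the roots that are orthogonal to all of them;
    irreducibility leaves no root of the second kind. *)
Lemma root_linked_axis gamma : Phi gamma ->
  exists f, [/\ axis f, linked e0 f & B f gamma != 0].
Proof.
have [P2e0 _] := ax_e0.
pose P gamma := exists f, [/\ axis f, linked e0 f & B f gamma != 0].
apply: (Phi_irreducible (P := P) P2e0).
  exists e0; split=> //; first by left.
  by rewrite BMnr mulf_neq0 ?pnatr_eq0 ?axis_norm_neq0.
move=> gamma1 delta Pg Pd [f [ax_f e0f fg]] nPd.
have orth m : axis m -> linked e0 m -> B m delta = 0.
  by move=> ax_m e0m; apply/eqP/negPn/negP => md; case: nPd; exists m.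
have [->|->|[gg fg2]] := axis_root ax_f Pg fg.
- by rewrite BMnl orth // mulr0.
- by rewrite BNl BMnl orth // mulr0 oppr0.
have gg0 := Phi_neq0 Pg; have ax_f' := axis_reflect ax_f Pg.
have f'_linked : linked e0 (reflect_by gamma1 f).
  apply: (linked_trans ax_e0 ax_f) => //; right; rewrite /reflect_by opprB addrC subrK.
  case: fg2 => ->; rewrite ?mulNr divff // ?scale1r ?scaleN1r //.
  exact: Phi_opp.
have := orth _ ax_f' f'_linked; rewrite /reflect_by !BE orth // sub0r => /eqP.
rewrite oppr_eq0 mulf_eq0 => /orP[|/eqP//].
by rewrite !mulf_eq0 invr_eq0 (negPf gg0) (negPf fg) pnatr_eq0.
Qed.

(** The axis linked to e0 to which the root 2 f is not orthogonal can only be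
    ±f. *)
Lemma linked_axes f : axis f -> linked e0 f.
Proof.
move=> ax_f; have [P2f _] := ax_f.
have [m [ax_m e0m mf]] := root_linked_axis P2f.
apply: (linked_trans ax_e0 ax_m) => //.
have [->|->|mf0] := axis_orthogonal ax_m ax_f; first by left.
  by right; rewrite -opprD -mulr2n; apply: Phi_opp.
by case/eqP: mf; rewrite BMnr mf0 mulr0.
Qed.

End Connected.

Lemma axes_linked e f : axis e -> axis f -> e = f \/ Phi (e - f).
Proof. by move=> ax_e; apply: linked_axes. Qed.

Lemma axes_norm e f : axis e -> axis f -> B e e = B f f.
Proof. by move=> ax_e ax_f; apply: linked_norm => //; apply: axes_linked. Qed.

(** The reflection in gamma maps an axis f that is not orthogonal to gamma to an
    axis that differs from f by ±gamma. *)
Lemma root_axes e0 gamma : axis e0 -> Phi gamma ->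
  (exists2 e, axis e & gamma = e *+ 2) \/
  (exists e f, [/\ axis e, axis f, B e f = 0 & gamma = e - f]).
Proof.
move=> ax_e0 Pg; have [f [ax_f _ fg]] := root_linked_axis ax_e0 Pg.
have [->|->|[gg fg2]] := axis_root ax_f Pg fg.
- by left; exists f.
- by left; exists (- f); rewrite ?mulNrn //; apply: axis_opp.
have gg0 := Phi_neq0 Pg; have ax_f' := axis_reflect ax_f Pg.
have f'E : reflect_by gamma f = f - gamma \/ reflect_by gamma f = f + gamma.
  rewrite /reflect_by; case: fg2 => ->; [left|right].
    by rewrite divff ?scale1r.
  by rewrite mulNr divff // scaleN1r opprK.
have [gE|gE] : gamma = f - reflect_by gamma f \/ gamma = reflect_by gamma f - f.
  by case: f'E => ->; [left; rewrite opprB addrC subrK | right; rewrite addrC addKr].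
- have [ff'|ff'|ff'0] := axis_orthogonal ax_f ax_f'.
  + by case/eqP: gg0; rewrite gE -ff' subrr B0l.
  + left; exists f => //; rewrite gE mulr2n; congr (_ + _).
    by rewrite {2}ff'.
  by right; exists f, (reflect_by gamma f).
have [ff'|ff'|ff'0] := axis_orthogonal ax_f' ax_f.
- by case/eqP: gg0; rewrite gE ff' subrr B0l.
- left; exists (- f); first exact: axis_opp.
  by rewrite {1}gE ff' mulr2n.
by right; exists (reflect_by gamma f), f.
Qed.

Lemma reflect_exchange e f : axis e -> axis f -> e <> f -> reflect_by (e - f) e = f.
Proof.
move=> ax_e ax_f ef; have ff0 := axis_norm_neq0 ax_f.
have ee := axes_norm ax_e ax_f.
suff coef : 2%:R * B e (e - f) = B (e - f) (e - f).
  have [//|/Phi_neq0 norm0] := axes_linked ax_e ax_f.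
  by rewrite /reflect_by coef divff // scale1r opprB addrC subrK.
have [//|->|ef0] := axis_orthogonal ax_e ax_f; first by rewrite !BE; ring.
by rewrite !BE (B_sym f) ef0 ee; ring.
Qed.

(** * Simple roots of an irreducible root system that has an axis *)

(** D is the part in Phi of a base of a possibly larger root system, and ht is the
    height relative to that base. That D spans Phi is expressed through the linear
    forms B(., v), as it will be applied to partial sums of axes. *)
Section SimpleRoots.
Variables (e0 : V) (D : V -> Prop) (ht : V -> K) (r : seq V).
Hypothesis ax_e0 : axis e0.
Hypothesis ht_lin : forall c u v, ht (c *: u + v) = c * ht u + ht v.
Hypothesis ht_root : forall gamma, Phi gamma -> 1 <= ht gamma \/ 1 <= - ht gamma.
Hypothesis D_simple : forall d, D d -> Phi d /\ ht d = 1.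
Hypothesis D_span : forall v, (forall d, D d -> B d v = 0) ->
  forall gamma, Phi gamma -> B gamma v = 0.
Hypothesis Phi_r : forall gamma, Phi gamma -> gamma \in r.

Let htD u v : ht (u + v) = ht u + ht v.
Proof. by have := ht_lin 1 u v; rewrite scale1r mul1r. Qed.

Let htN u : ht (- u) = - ht u.
Proof.
have ht0 : ht 0 = 0 by apply: (addIr (ht 0)); rewrite -htD !add0r.
by have := ht_lin (-1) u 0; rewrite !addr0 scaleN1r mulN1r ht0 addr0.
Qed.

Definition positive_axis e := axis e /\ 0 < ht e.

(** Positive roots have height at least 1, and simple ones have height 1. *)
Lemma simple_indecomposable d gamma delta : D d ->
  Phi gamma -> 0 < ht gamma -> Phi delta -> 0 < ht delta -> d <> gamma + delta.
Proof.
have ht_ge1 u : Phi u -> 0 < ht u -> 1 <= ht u.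
  move=> /ht_root[//|u_le] u_gt; have := lt_le_trans ltr01 u_le.
  by rewrite oppr_gt0 => /(lt_trans u_gt); rewrite ltxx.
move=> /D_simple[_ htd] Pg g_gt0 Pd d_gt0 dE.
have := lerD (ht_ge1 _ Pg g_gt0) (ht_ge1 _ Pd d_gt0).
by rewrite -htD -dE htd gerDl ler10.
Qed.

Lemma axis_sign e : axis e -> positive_axis e \/ positive_axis (- e).
Proof.
move=> ax_e; have [/ht_root ht2 _] := ax_e.
case: ht2; rewrite mulr2n htD -?opprD -?mulr2n => /(lt_le_trans ltr01).
  by rewrite pmulrn_lgt0 // => e_gt0; left.
rewrite -mulNrn pmulrn_lgt0 // => e_gt0.
by right; split; [apply: axis_opp | rewrite htN].
Qed.

Lemma positive_axis_diff e f :
  positive_axis e -> positive_axis f -> e != f -> Phi (e - f).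
Proof.
by case=> ax_e _ [ax_f _]; case: (axes_linked ax_e ax_f) => // ->; rewrite eqxx.
Qed.

Lemma positive_axis_sum e f : positive_axis e -> positive_axis f -> e != f ->
  Phi (e + f) /\ 0 < ht (e + f).
Proof.
case=> ax_e e_gt0 [ax_f f_gt0] ef; split; last by rewrite htD addr_gt0.
have [e_f|] := axes_linked ax_e (axis_opp ax_f); last by rewrite opprK.
by move: e_gt0; rewrite e_f htN oppr_gt0 => /(lt_trans f_gt0); rewrite ltxx.
Qed.

Lemma positive_axis_double e : positive_axis e -> Phi (e *+ 2) /\ 0 < ht (e *+ 2).
Proof. by case=> -[P2e _] e_gt0; split; rewrite // mulr2n htD addr_gt0. Qed.

(** The positive axes ε_1, ..., ε_n, by decreasing height, so that ε_i - ε_k is a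
    positive root for i < k. *)
Definition axes : seq V :=
  sort (fun e f => ht f <= ht e)
    [seq e <- undup [seq 2%:R^-1 *: gamma | gamma <- r] | `[< positive_axis e >]].

Lemma mem_axes e : e \in axes <-> positive_axis e.
Proof.
rewrite mem_sort mem_filter mem_undup; split=> [/andP[/asboolP //]|pos_e].
apply/andP; split; first exact/asboolP.
apply/mapP; exists (e *+ 2); first by apply: Phi_r; case: pos_e => -[].
by rewrite -scaler_nat scalerA mulVf ?scale1r // pnatr_eq0.
Qed.

Local Notation s := axes.

Lemma nth_axes i : (i < size s)%N -> positive_axis s`_i.
Proof. by move=> lt_is; apply/mem_axes; rewrite mem_nth. Qed.

Lemma uniq_axes : uniq s.
Proof. by rewrite sort_uniq filter_uniq // undup_uniq. Qed.

Lemma axes_gt i j : (i < j)%N -> (j < size s)%N -> 0 < ht (s`_i - s`_j).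
Proof.
move=> lt_ij lt_js; have lt_is := ltn_trans lt_ij lt_js.
have htr : {in [pred e | ht e \is Num.real] &,
    total (fun e f => ht f <= ht e)}.
  by move=> e f e_real f_real; apply: real_leVge.
have s_sorted : sorted (fun e f => ht f <= ht e) s.
  rewrite /axes; apply: (sort_sorted_in htr); apply/allP => e.
  by rewrite mem_filter => /andP[/asboolP[_ /gtr0_real]].
have ht_trans : transitive (fun e f => ht f <= ht e).
  by move=> f e m fe mf; apply: le_trans mf fe.
have /= := sorted_ltn_nth ht_trans 0 s_sorted i j lt_is lt_js lt_ij.
rewrite -subr_ge0 -htN -htD => ht_ge0.
have sij : s`_i != s`_j by rewrite nth_uniq ?uniq_axes // neq_ltn lt_ij.
have Pij := positive_axis_diff (nth_axes lt_is) (nth_axes lt_js) sij.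
case: (ht_root Pij) => [/(lt_le_trans ltr01)//|/(lt_le_trans ltr01)].
by rewrite oppr_gt0 => /(le_lt_trans ht_ge0); rewrite ltxx.
Qed.

Lemma size_axes_gt0 : (0 < size s)%N.
Proof.
by case: (axis_sign ax_e0) => /mem_axes; case: s.
Qed.

Lemma B_axes i j : (i < size s)%N -> (j < size s)%N ->
  B s`_i s`_j = B e0 e0 * (i == j)%:R.
Proof.
move=> lt_is lt_js; have [ax_i i_gt0] := nth_axes lt_is.
have [ax_j j_gt0] := nth_axes lt_js.
have [->|ij] := eqVneq i j; first by rewrite mulr1 (axes_norm ax_j ax_e0).
rewrite mulr0; have [s_ij|s_ij|//] := axis_orthogonal ax_i ax_j.
  by case/eqP: ij; apply/eqP; rewrite -(nth_uniq 0 lt_is lt_js uniq_axes) s_ij.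
by move: i_gt0; rewrite s_ij htN oppr_gt0 => /(lt_trans j_gt0); rewrite ltxx.
Qed.

(** The Bourbaki simple roots ε_i - ε_(i+1) and 2 ε_n, numbered from 0. *)
Definition simple_root i :=
  if i.+1 == size s then s`_i *+ 2 else s`_i - s`_i.+1.

(** The other positive roots are sums of two positive roots: for instance,
    2 ε_i = (ε_i - ε_(i+1)) + (ε_i + ε_(i+1)). *)
Lemma simple_root_complete d : D d -> exists2 i, (i < size s)%N & d = simple_root i.
Proof.
move=> Dd; have [Pd htd] := D_simple Dd.
have pick e : positive_axis e -> exists2 i, (i < size s)%N & e = s`_i.
  by move/mem_axes=> s_e; exists (index e s); rewrite ?index_mem ?nth_index.
have pos i j : (i < j)%N -> (j < size s)%N ->
    Phi (s`_i - s`_j) /\ 0 < ht (s`_i - s`_j).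
  move=> lt_ij lt_js; split; last exact: axes_gt.
  have lt_is := ltn_trans lt_ij lt_js.
  apply: positive_axis_diff; try exact: nth_axes.
  by rewrite nth_uniq ?uniq_axes // neq_ltn lt_ij.
have sum_case i j : (i < j)%N -> (j < size s)%N -> d <> s`_i + s`_j.
  move=> lt_ij lt_js; have [P1 h1] := pos _ _ lt_ij lt_js.
  have [P2 h2] := positive_axis_double (nth_axes lt_js).
  have := simple_indecomposable Dd P1 h1 P2 h2.
  by rewrite mulr2n addrA addrNK.
have diff_case i j : (i < size s)%N -> (j < size s)%N -> d = s`_i - s`_j ->
    exists2 i, (i < size s)%N & d = simple_root i.
  move=> lt_is lt_js dE; have [lt_ij|lt_ji|ij] := ltngtP i j.
  - exists i => //; rewrite /simple_root ltn_eqF; last exact: leq_trans lt_js.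
    have [->//|i1j] := eqVneq i.+1 j.
    have lt_i1j : (i.+1 < j)%N by rewrite ltn_neqAle i1j.
    have [P1 h1] := pos _ _ (ltnSn i) (ltn_trans lt_i1j lt_js).
    have [P2 h2] := pos _ _ lt_i1j lt_js.
    by case: (simple_indecomposable Dd P1 h1 P2 h2); rewrite addrA addrNK.
  - have [_] := pos _ _ lt_ji lt_is.
    by rewrite -opprB -dE htN htd oppr_gt0 => /(lt_trans ltr01); rewrite ltxx.
  by move: htd (@ltr01 K); rewrite dE ij htD htN subrr => <-; rewrite ltxx.
have [[e ax_e dE]|[e [f [ax_e ax_f ef0 dE]]]] := root_axes ax_e0 Pd.
  have /pick[i lt_is eE] : positive_axis e.
    case: (axis_sign ax_e) => // -[_ e_gt0]; have := addr_gt0 e_gt0 e_gt0.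
    rewrite !htN -opprD -htD -mulr2n -dE htd oppr_gt0 => /(lt_trans ltr01).
    by rewrite ltxx.
  exists i => //; rewrite /simple_root dE eE; case: eqP => // /eqP i1s.
  have lt_i1s : (i.+1 < size s)%N by rewrite ltn_neqAle i1s.
  have [P1 h1] := pos _ _ (ltnSn i) lt_i1s.
  have [|P2 h2] := positive_axis_sum (nth_axes lt_is) (nth_axes lt_i1s).
    by rewrite nth_uniq ?uniq_axes // ltn_eqF.
  case: (simple_indecomposable Dd P1 h1 P2 h2).
  by rewrite dE eE addrACA addNr addr0 mulr2n.
have [pos_e|pos_e] := axis_sign ax_e; have [pos_f|pos_f] := axis_sign ax_f.
- have [i lt_is eE] := pick _ pos_e; have [j lt_js fE] := pick _ pos_f.
  by apply: (diff_case i j); rewrite // dE eE fE.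
- have [i lt_is eE] := pick _ pos_e; have [j lt_js fE] := pick _ pos_f.
  have {}dE : d = s`_i + s`_j by rewrite dE eE -fE.
  have [lt_ij|lt_ji|ij] := ltngtP i j; first by case: (sum_case i j).
    by case: (sum_case j i); rewrite // addrC.
  have /eqP : B e (- f) = 0 by rewrite BNr ef0 oppr0.
  by rewrite fE -ij -eE (negPf (axis_norm_neq0 ax_e)).
- have [_ e_gt0] := pos_e; have [_ f_gt0] := pos_f.
  have := addr_gt0 e_gt0 f_gt0.
  rewrite -htD -[f]opprK -opprD htN -dE htd oppr_gt0 => /(lt_trans ltr01).
  by rewrite ltxx.
have [i lt_is eE] := pick _ pos_e; have [j lt_js fE] := pick _ pos_f.
by apply: (diff_case j i); rewrite // dE -eE -fE opprK addrC.
Qed.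

(** The partial sums of the ε_l are dual to the simple_root k, up to scaling: they
    are multiples of the fundamental coweights. *)
Lemma B_simple_root_partial_sum i k : (i < size s)%N -> (k < size s)%N ->
  (B (simple_root k) (\sum_(l < i.+1) s`_l) == 0) = (k != i).
Proof.
move=> lt_is lt_ks.
have Bsum (m : nat) : (m < size s)%N ->
    B s`_m (\sum_(l < i.+1) s`_l) = B e0 e0 * (m <= i)%:R.
  move=> lt_ms; rewrite (big_morph (B s`_m) (id1 := 0) (op1 := +%R)); last first.
  - by rewrite B_sym B0l.
  - by move=> x y; rewrite BDr.
  rewrite (eq_bigr (fun l : 'I_i.+1 => B e0 e0 * (m == l)%:R)); last first.
    by move=> l _; rewrite B_axes // (leq_trans (ltn_ord l)).
  rewrite -mulr_sumr; congr (_ * _); have [le_mi|lt_im] := leqP m i.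
    rewrite (bigD1 (Ordinal (le_mi : m < i.+1)%N)) //= eqxx big1 ?addr0 // => l.
    by rewrite -val_eqE /= eq_sym => /negPf->.
  by rewrite big1 // => l _; rewrite gtn_eqF // (leq_trans (ltn_ord l)).
have nz := axis_norm_neq0 ax_e0.
rewrite /simple_root; case: (k.+1 =P size s) => [k1s|/eqP k1s].
  rewrite BMnl Bsum // !mulf_eq0 pnatr_eq0 (negPf nz) /=.
  by rewrite pnatr_eq0 eqb0 -ltnNge; apply/idP/idP; lia.
have lt_k1s : (k.+1 < size s)%N by rewrite ltn_neqAle k1s.
rewrite BDl BNl !Bsum // -mulrBr mulf_eq0 (negPf nz) /=.
by have [ki|ki|ki] := ltngtP k i; rewrite ?subrr ?subr0 ?eqxx ?oner_eq0.
Qed.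

(** D spans, so it has an element that is not orthogonal to the i-th partial sum
    of the axes; among the roots simple_root k, only simple_root i is such. *)
Lemma simple_root_simple i : (i < size s)%N -> D (simple_root i).
Proof.
move=> lt_is; have := B_simple_root_partial_sum lt_is lt_is; rewrite eqxx.
move/negbT; set v := \sum_(_ < _) _ => B_iv.
have Pi : Phi (simple_root i).
  rewrite /simple_root; case: eqP => [_|/eqP i1s].
    by case: (positive_axis_double (nth_axes lt_is)).
  have lt_i1s : (i.+1 < size s)%N by rewrite ltn_neqAle i1s.
  apply: positive_axis_diff; try exact: nth_axes.
  by rewrite nth_uniq ?uniq_axes // ltn_eqF.
have [d [Dd dv]] : exists d, D d /\ B d v <> 0.
  apply: contrapT => no_d; case/eqP: B_iv; apply: D_span Pi => d Dd.
  by apply: contrapT => dv; case: no_d; exists d.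
have [k lt_ks dE] := simple_root_complete Dd.
have [ki|ki] := eqVneq k i; first by rewrite -ki -dE.
by move: ki; rewrite -(B_simple_root_partial_sum lt_is lt_ks) -dE => /eqP.
Qed.

Lemma simple_root_norm i : (i < size s)%N ->
  B (simple_root i) (simple_root i) = (if i.+1 == size s then 4%:R else 2%:R) * B e0 e0.
Proof.
move=> lt_is; rewrite /simple_root; case: (i.+1 =P size s) => [_|/eqP i1s].
  by rewrite !BE B_axes // eqxx /=; ring.
have lt_i1s : (i.+1 < size s)%N by rewrite ltn_neqAle i1s.
rewrite !BE !B_axes // !eqxx (ltn_eqF (ltnSn i)) (gtn_eqF (ltnSn i)) /=; ring.
Qed.

Lemma simple_root_cartan_C n (i k : 'I_n.+2) : size s = n.+2 ->
  2%:R * B (simple_root i) (simple_root k) / B (simple_root k) (simple_root k) =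
  (cartan_C n.+2 i k)%:~R.
Proof.
move=> size_s; have q0 := axis_norm_neq0 ax_e0.
have lt_is : (i < size s)%N by rewrite size_s.
have lt_ks : (k < size s)%N by rewrite size_s.
rewrite simple_root_norm // mxE -val_eqE /= /simple_root size_s !eqSS.
have [ik|ik] := eqVneq (i : nat) k.
  rewrite -ik; case: ((i : nat) =P n.+1) => [_|/eqP i1s].
    by rewrite !BE B_axes // eqxx /=; field.
  have lt_i1s : (i.+1 < size s)%N by rewrite ltn_neqAle size_s eqSS i1s /=.
  by rewrite !BE !B_axes // !eqxx (ltn_eqF (ltnSn i)) (gtn_eqF (ltnSn i)) /=; field.
case: ((i : nat) =P n.+1) => [i1s|/eqP i1s].
  have k1s : ((k : nat) == n.+1) = false by lia.
  have lt_k1s : (k.+1 < size s)%N by rewrite ltn_neqAle size_s eqSS k1s /=.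
  rewrite k1s !BE !B_axes // (negPf ik) (_ : (i.+1 == k) = false); last by lia.
  by rewrite (eq_sym (i : nat)); case: eqP => _ /=; field.
have lt_i1s : (i.+1 < size s)%N by rewrite ltn_neqAle size_s eqSS i1s /=.
case: ((k : nat) =P n.+1) => [k1s|/eqP k1s].
  rewrite !BE !B_axes // (negPf ik) (_ : (k.+1 == i) = false) ?orbF; last by lia.
  by case: eqP => _ /=; field.
have lt_k1s : (k.+1 < size s)%N by rewrite ltn_neqAle size_s eqSS k1s /=.
rewrite !BE !B_axes // eqSS (negPf ik) (eq_sym (i : nat)).
case: (i.+1 =P k) => [i1k|_]; last by case: eqP => _ /=; field.
by rewrite (_ : (k.+1 == i) = false) /=; [field | lia].
Qed.

Lemma first_axis_fundamental k : (k < size s)%N ->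
  2%:R * B s`_0 (simple_root k) / B (simple_root k) (simple_root k) = (k == 0)%:R.
Proof.
move=> lt_ks; have q0 := axis_norm_neq0 ax_e0; have s0 := size_axes_gt0.
rewrite simple_root_norm // /simple_root; case: (k.+1 =P size s) => [_|/eqP k1s].
  by rewrite !BE B_axes // eq_sym; case: eqP => _ /=; field.
have lt_k1s : (k.+1 < size s)%N by rewrite ltn_neqAle k1s.
by rewrite !BE !B_axes // eq_sym; case: eqP => _ /=; field.
Qed.

Lemma simple_root_inj : {in [pred i | (i < size s)%N] &, injective simple_root}.
Proof.
move=> i k lt_is lt_ks ik; apply/eqP/negPn.
rewrite -(B_simple_root_partial_sum lt_ks lt_is).
by rewrite ik (B_simple_root_partial_sum lt_ks lt_ks) eqxx.
Qed.

(** omega takes the values of the first fundamental weight at the coroots of the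
    entries of a. *)
Definition simple_system n (a : n.+1.-tuple V) omega :=
  [/\ uniq a, forall d, d \in a <-> D d, axis omega
    & forall k, 2%:R * B omega (tnth a k) / B (tnth a k) (tnth a k) =
                (k == ord0)%:R].

Lemma simple_system_axes n : size s = n.+1 ->
  simple_system [tuple simple_root i | i < n.+1] s`_0.
Proof.
move=> size_s; split.
- apply/tuple_uniqP => i k; rewrite !tnth_mktuple => /simple_root_inj ik.
  by apply/val_inj/ik; rewrite inE size_s.
- move=> d; split=> [/tnthP[i ->]|/simple_root_complete[i lt_is ->]].
    by rewrite tnth_mktuple; apply: simple_root_simple; rewrite size_s.
  rewrite size_s in lt_is.
  by apply/tnthP; exists (Ordinal lt_is); rewrite tnth_mktuple.
- by case: (nth_axes size_axes_gt0).
by move=> k; rewrite tnth_mktuple first_axis_fundamental // size_s.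
Qed.

Lemma simple_system_A1_or_C :
  (exists a omega, @simple_system 0 a omega /\ (e0 = omega \/ e0 = - omega)) \/
  (exists n a omega, @simple_system n.+1 a omega /\
     forall i k, 2%:R * B (tnth a i) (tnth a k) / B (tnth a k) (tnth a k) =
                 (cartan_C n.+2 i k)%:~R).
Proof.
have := size_axes_gt0; case size_s: (size s) => [//|[|n]] _; [left | right].
  exists [tuple simple_root i | i < 1], s`_0; split.
    exact: simple_system_axes.
  have s0 e : e \in s -> e = s`_0.
    by move=> s_e; rewrite -(nth_index 0 s_e); congr nth;
      move: s_e; rewrite -index_mem size_s; case: index.
  case: (axis_sign ax_e0) => /mem_axes/s0; first by left.
  by right; apply: oppr_inj; rewrite opprK.
exists n, [tuple simple_root i | i < n.+2], s`_0; split.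
  exact: simple_system_axes.
by move=> i k; rewrite !tnth_mktuple simple_root_cartan_C.
Qed.

End SimpleRoots.

End Axes.

(** * The Killing form of a semisimple Lie algebra is nondegenerate *)

Section SemisimpleStructure.
Variables (K : numFieldType) (L : lieAlgType K) (h : {vspace L}).
Variables (N : nat) (g_ : 'I_N -> {vspace L}).
Notation hdual := 'Hom(subvs_of h, K^o).
Implicit Types (x y z u v : L) (U V : {vspace L}) (lam mu : hdual).
Implicit Types (alpha beta gamma delta : hdual) (H : subvs_of h).

Hypothesis L_semisimple : semisimple L.
Hypothesis g_ideal : forall i, is_ideal (g_ i).
Hypothesis g_simple : forall i, is_simple (g_ i).
Hypothesis g_direct : directv (\sum_i g_ i)%VS.
Hypothesis g_sum : (\sum_i g_ i)%VS = fullv.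
Hypothesis h_cartan : is_cartan h.

(** A basis of weight vectors; wt lists the weights with multiplicities,
    including the weight 0 of the elements of h. *)
Variables (n : nat) (e : n.-tuple L) (wt : 'I_n -> hdual).
Hypothesis e_basis : basis_of fullv e.
Hypothesis e_wt : forall i, weight_vector (wt i) e`_i.

Lemma coord_lie H x i :
  coord e i (lie (vsval H) x) = (wt i H : K) * coord e i x.
Proof.
rewrite {1}(coordE e_basis x) lie_sumr.
under eq_bigr => j _ do rewrite lieZr e_wt scalerA.
by rewrite coord_sum_free ?(basis_free e_basis) // mulrC.
Qed.

Lemma coord_weight lam x i :
  weight_vector lam x -> coord e i x != 0 -> wt i = lam.
Proof.
move=> wx xi; apply/lfunP => H; apply: (mulIf xi).
by rewrite -coord_lie wx linearZ.
Qed.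

Lemma weight_coord_neq0 x : x != 0 -> exists i, coord e i x != 0.
Proof.
move=> x0; apply/existsP; apply: contraNT x0 => /existsPn x0.
rewrite (coordE e_basis x) big1 // => i _.
by move/negbNE/eqP: (x0 i) => ->; rewrite scale0r.
Qed.

Lemma weight_wt lam x : weight_vector lam x -> x != 0 -> exists i, wt i = lam.
Proof.
by move=> wx /weight_coord_neq0[i xi]; exists i; apply: coord_weight wx xi.
Qed.

Lemma weight0_mem x : weight_vector (0 : hdual) x -> x \in h.
Proof.
move=> wx; apply: cartan_centralizer => // y hy.
by have := wx (vsproj h y); rewrite vsprojK // zero_lfunE scale0r.
Qed.

Lemma mem_weight0 x : x \in h -> weight_vector (0 : hdual) x.
Proof.
move=> hx H; rewrite zero_lfunE scale0r (cartan_commutes h_cartan) //.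
exact: subvsP.
Qed.

Lemma wt_separates H : (forall i, wt i H = 0) -> H = 0.
Proof.
move=> wtH; apply: val_inj => /=; apply: semisimple_center0 => // x.
rewrite (coordE e_basis x) lie_sumr big1 // => i _.
by rewrite lieZr e_wt wtH scale0r scaler0.
Qed.

Lemma killing_cartan H1 H2 :
  killing (vsval H1) (vsval H2) = \sum_i (wt i H1 : K) * wt i H2.
Proof.
rewrite /killing (traceE e_basis); apply: eq_bigr => i _.
rewrite comp_lfunE !adE !coord_lie coord_free ?(basis_free e_basis) //.
by rewrite eqxx mulr1.
Qed.

Lemma killing_weight lam mu x y :
    weight_vector lam x -> weight_vector mu y -> lam + mu != 0 ->
  killing x y = 0.
Proof.
move=> wx wy; apply: contraNeq => Bxy; apply/eqP/lfunP => H.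
rewrite zero_lfunE add_lfunE; apply: (mulIf Bxy).
rewrite mul0r mulrDl -killingZl -killingZr -wx -wy -killing_invariant.
by rewrite -killingDl (lieC x) addrN killing0l.
Qed.

Lemma cartan_lie_weight alpha x y :
    weight_vector alpha x -> weight_vector (- alpha) y ->
  lie x y \in h.
Proof.
move=> wx wy; apply: weight0_mem; rewrite -(subrr alpha).
exact: weight_vector_lie.
Qed.

(** As x and y both act on the sum of the weight spaces of weights wt i + m alpha,
    the bracket [x, y] has trace 0 there; this trace is a positive multiple of
    wt i plus an integral multiple of alpha, evaluated at [x, y]. *)
Lemma weight_string_real alpha x y i :
    weight_vector alpha x -> weight_vector (- alpha) y ->
  exists2 q : K, q \is Num.real
    & wt i (vsproj h (lie x y)) = q * alpha (vsproj h (lie x y)).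
Proof.
move=> wx wy; set H := vsproj h _.
have HE : vsval H = lie x y by rewrite vsprojK ?(cartan_lie_weight wx wy).
pose T j := `[< exists m : int, wt j = wt i + alpha *~ m >].
have T_shift (m0 : int) u j k : weight_vector (alpha *~ m0) u ->
    T j -> ~~ T k -> coord e k (ad u e`_j) = 0.
  move=> wu /asboolP[m wj]; apply: contraNeq; rewrite adE.
  move/(coord_weight (weight_vector_lie wu (e_wt j))) => wk.
  by apply/asboolP; exists (m + m0); rewrite wk wj mulrzDr addrC addrA.
have tr0 : \sum_(j | T j) (wt j H : K) = 0.
  have /= trC := partial_traceC e_basis (T := T) (f := ad x) (g := ad y).
  have -> : \sum_(j | T j) (wt j H : K) =
            \sum_(j | T j) coord e j (ad x (ad y e`_j)) -
            \sum_(j | T j) coord e j (ad y (ad x e`_j)).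
    rewrite -sumrB; apply: eq_bigr => j _.
    rewrite -linearB /= !adE (lie_derivation x y) addrK -HE coord_lie.
    by rewrite coord_free ?(basis_free e_basis) // eqxx mulr1.
  apply/eqP; rewrite subr_eq0; apply/eqP; apply: trC => j k.
    by apply: (T_shift 1); rewrite mulr1z.
  by apply: (T_shift (-1)); rewrite mulrN1z.
have /fin_all_exists[m mP] (j : 'I_n) : exists m : int,
    T j -> wt j = wt i + alpha *~ m.
  have [/asboolP[m wj] | _] := boolP (T j); first by exists m.
  by exists 0.
have Ti : T i by apply/asboolP; exists 0; rewrite mulr0z addr0.
have T_gt0 : (#|T|%:R : K) != 0.
  by rewrite pnatr_eq0 -lt0n; apply/card_gt0P; exists i.
exists (- (\sum_(j | T j) (m j)%:~R) / #|T|%:R).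
  by rewrite rpred_div ?rpred_nat // rpredN rpred_sum // => j _; apply: rpred_int.
apply: (mulIf T_gt0); rewrite mulrAC mulfVK // mulNr.
apply/eqP; rewrite -addr_eq0 mulr_natr -sumr_const mulr_suml -big_split /=.
rewrite -[eqbRHS]tr0; apply/eqP/eq_bigr => j Tj.
by rewrite (mP j Tj) add_lfunE -scaler_int scale_lfunE.
Qed.

(** By weight_string_real, all weights vanish at [x, y], which is thus central. *)
Lemma lie_opposite_eq0 alpha x y :
    weight_vector alpha x -> weight_vector (- alpha) y ->
  alpha (vsproj h (lie x y)) = 0 -> lie x y = 0.
Proof.
move=> wx wy alpha0; rewrite -(vsprojK (cartan_lie_weight wx wy)).
rewrite (wt_separates (H := vsproj h _)) // => i.
by have [q _ ->] := weight_string_real i wx wy; rewrite alpha0 mulr0.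
Qed.

Definition component j : 'End(L) := sumv_pi (\sum_i g_ i)%VS j.

Lemma component_mem j x : component j x \in g_ j.
Proof. exact: memv_sum_pi. Qed.

Lemma component_sum x : \sum_j component j x = x.
Proof. by apply: sumv_pi_sum; rewrite g_sum memvf. Qed.

Lemma component_unique (us : 'I_N -> L) j :
  (forall i, us i \in g_ i) -> component j (\sum_i us i) = us j.
Proof.
move=> us_g; apply/eqP; rewrite -subr_eq0; apply/eqP.
apply: (directv_sum_independent g_direct
          (fun i => component i (\sum_i us i) - us i)) => // [i _|].
  by rewrite memvB ?component_mem.
by rewrite sumrB component_sum subrr.
Qed.

Lemma component_id i j x : x \in g_ j -> component i x = if i == j then x else 0.
Proof.
move=> gx; pose us k := if k == j then x else 0.
have {1}<-: \sum_k us k = x by rewrite -big_mkcond big_pred1_eq.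
rewrite (component_unique (us := us)) // => k.
by rewrite /us; case: eqP => [->|_]; rewrite ?mem0v.
Qed.

Lemma g_lier i x y : y \in g_ i -> lie x y \in g_ i.
Proof. by apply: (lie_prodP _ _ _ (g_ideal i)); apply: memvf. Qed.

Lemma g_liel i x y : x \in g_ i -> lie x y \in g_ i.
Proof. by move=> gx; rewrite lieC memvN g_lier. Qed.

Lemma g_stable i : cartan_stable h (g_ i).
Proof. by move=> z x _; apply: g_lier. Qed.

Lemma g_commute i j x y : i != j -> x \in g_ i -> y \in g_ j -> lie x y = 0.
Proof.
move=> ij gx gy; have := component_id i (g_lier x gy).
by rewrite (negPf ij) (component_id i (g_liel y gx)) eqxx.
Qed.

Lemma component_lie j z x : component j (lie z x) = lie z (component j x).
Proof.
rewrite -{1}(component_sum x) lie_sumr.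
rewrite (component_unique (us := fun i => lie z (component i x))) // => i.
by rewrite g_lier ?component_mem.
Qed.

Lemma lie_component j x y : y \in g_ j -> lie x y = lie (component j x) y.
Proof.
move=> gy; rewrite -{1}(component_sum x) lie_suml (bigD1 j) //= big1 ?addr0 //.
by move=> i ij; apply: (g_commute ij _ gy); apply: component_mem.
Qed.

Lemma component_cartan j x : x \in h -> component j x \in h.
Proof.
move=> hx; apply: cartan_centralizer => // y hy.
by rewrite -component_lie (cartan_commutes h_cartan) ?linear0.
Qed.

Lemma g_perfect j : lie_prod (g_ j) (g_ j) = g_ j.
Proof.
have [g0 gI] := g_simple j; case: (gI (lie_prod (g_ j) (g_ j))) => //.
  by apply/lie_prodP => x y _; apply: g_lier.
apply/lie_prodP => x y gx gy; apply: mem_lie_prod => //.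
by apply: subvP y gy; apply/lie_prodP => u v _; apply: g_lier.
Qed.

Definition killing_radical : {vspace L} :=
  lker (linfun (fun x => linfun (killing x : L -> K^o))).

Lemma mem_killing_radical x :
  reflect (forall y, killing x y = 0) (x \in killing_radical).
Proof.
have kr_linear : linear (fun x => linfun (killing x : L -> K^o)).
  move=> c u v; apply/lfunP => z; rewrite add_lfunE scale_lfunE.
  rewrite !(linfunE_linear (@killing_linearr _ _ _)).
  exact: killing_linearl.
rewrite memv_ker linfunE_linear //; apply: (iffP eqP) => [/lfunP x0 y|x0].
  by have := x0 y; rewrite linfunE_linear ?zero_lfunE //; apply: killing_linearr.
by apply/lfunP => y; rewrite linfunE_linear ?zero_lfunE //; apply: killing_linearr.
Qed.

Lemma killing_radical_liel x y :
  x \in killing_radical -> lie x y \in killing_radical.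
Proof.
move/mem_killing_radical=> x0; apply/mem_killing_radical=> z.
by rewrite killing_invariant.
Qed.

(** With H = [x, y] in the radical, 0 = B(H, H) is the sum of the squares of the
    weights at H, and these are real multiples of alpha(H). So alpha(H) = 0. *)
Lemma killing_radical_lie0 alpha x y : x \in killing_radical ->
  weight_vector alpha x -> weight_vector (- alpha) y -> lie x y = 0.
Proof.
move=> Sx wx wy; have [->|x0] := eqVneq x 0; first by rewrite lie0l.
have [i0 i0_alpha] := weight_wt wx x0.
apply: (lie_opposite_eq0 wx wy); set H := vsproj h _.
have HE : vsval H = lie x y by rewrite vsprojK ?(cartan_lie_weight wx wy).
have /fin_all_exists2[q q_real qP] (i : 'I_n) := weight_string_real i wx wy.
have [// | alphaH] := eqVneq (alpha H : K) 0.
have : killing (vsval H) (vsval H) = 0.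
  by apply/mem_killing_radical; rewrite HE killing_radical_liel.
rewrite killing_cartan; under eq_bigr => i _ do rewrite qP -expr2 exprMn.
rewrite -mulr_suml => /eqP; rewrite mulf_eq0 expf_eq0 /= (negPf alphaH) orbF.
rewrite psumr_eq0 => [|i _]; last by rewrite real_exprn_even_ge0.
move/allP=> /(_ i0 (mem_index_enum _)); rewrite expf_eq0 /= => /eqP q0.
by rewrite -i0_alpha qP q0 mul0r.
Qed.

(** If g_j were in the radical, brackets of opposite weight vectors of g_j would
    vanish and g_j = [g_j, g_j] would have no nonzero element in h. Then h would
    act trivially on g_j, so that g_j would be contained in h, hence zero. *)
Lemma g_not_sub_radical j : ~~ (g_ j <= killing_radical)%VS.
Proof.
apply/negP => gS.
have g_h0 x : x \in g_ j -> x \in h -> x = 0.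
  move=> gx hx; apply/eqP/negPn/negP => /weight_coord_neq0[i xi].
  have wi := coord_weight (mem_weight0 hx) xi.
  case/negP: xi; rewrite -g_perfect in gx.
  have coordE_lin y : linfun (coord e i : L -> K^o) y = coord e i y.
    by rewrite linfunE_linear // => c u v; rewrite linearP.
  suff: x \in lker (linfun (coord e i : L -> K^o)).
    by rewrite memv_ker coordE_lin.
  apply: (subvP _ x gx).
  apply/lie_prodP => y z gy gz; rewrite memv_ker coordE_lin.
  have [t -> tP] := weight_decomposition h_cartan (@g_stable j) gy.
  have [s -> sP] := weight_decomposition h_cartan (@g_stable j) gz.
  rewrite lie_suml linear_sum /= big_seq big1 // => v /tP[gv [lam wv]].
  rewrite lie_sumr linear_sum /= big_seq big1 // => w /sP[gw [mu ww]].
  apply/eqP/negPn/negP => vw; have := coord_weight (weight_vector_lie wv ww) vw.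
  rewrite wi => /esym/eqP; rewrite addrC addr_eq0 => /eqP mu_lam.
  rewrite mu_lam in ww; case/negP: vw.
  by rewrite (killing_radical_lie0 _ wv ww) ?linear0 //; apply: subvP gS _ gv.
have g_h : (g_ j <= h)%VS.
  apply/subvP => x gx; apply: cartan_centralizer => // y hy.
  rewrite (lie_component _ gx) (g_h0 (component j y)) ?lie0l //.
    exact: component_mem.
  exact: component_cartan.
have [g0 _] := g_simple j; apply: g0; apply: (proj1 (is_abelianP _)) => x y gx _.
by rewrite (g_h0 x) ?lie0l //; apply: subvP g_h _ gx.
Qed.

(** The radical meets each simple ideal in 0 or in the whole of it, which
    g_not_sub_radical excludes; so it commutes with all of them. *)
Lemma killing_nondegenerate x : (forall y, killing x y = 0) -> x = 0.
Proof.
move/mem_killing_radical=> Sx; apply: semisimple_center0 => // y.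
rewrite -(component_sum y) lie_sumr big1 // => j _.
have [_ gI] := g_simple j; have [||I0|Ig] := gI (killing_radical :&: g_ j)%VS.
- exact: capvSr.
- apply/lie_prodP => u v gu; rewrite !memv_cap => /andP[Sv gv].
  by rewrite g_lier // lieC memvN killing_radical_liel.
- apply/eqP; rewrite -memv0 -I0 memv_cap killing_radical_liel //.
  by rewrite g_lier ?component_mem.
by case/negP: (g_not_sub_radical j); rewrite -Ig capvSl.
Qed.

(** * The form on the dual of h, sl2-triples and root strings *)

Lemma killing_mapE H1 H2 : killing_map h H2 H1 = killing (vsval H1) (vsval H2).
Proof.
have lin2 (H : subvs_of h) : linear (fun X => killing (vsval X) (vsval H) : K^o).
  by move=> c u v; rewrite linearP killing_linearl.
rewrite /killing_map linfunE_linear ?linear_formE // => c u v.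
apply/lfunP => X; rewrite add_lfunE scale_lfunE !linear_formE //.
by rewrite linearP killing_linearr.
Qed.

Lemma killing_map_inj : lker (killing_map h) == 0%VS.
Proof.
rewrite -subv0; apply/subvP => H; rewrite memv_ker memv0 => /eqP/lfunP H0.
apply/eqP/val_inj => /=; apply: killing_nondegenerate => y.
rewrite killingC (coordE e_basis y); elim/big_rec: _ => [|i z _ z0].
  by rewrite killing0l.
rewrite killingDl z0 addr0 killingZl.
have [wi|wi] := eqVneq (wt i) 0.
  have hi : e`_i \in h by apply: weight0_mem; rewrite -wi.
  by rewrite -(vsprojK hi) -killing_mapE H0 zero_lfunE mulr0.
rewrite (killing_weight (e_wt i) (mem_weight0 (subvsP H))) ?mulr0 //.
by rewrite addr0.
Qed.

Lemma H_E lam H : lam H = killing (vsval H) (vsval (H_ lam)).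
Proof.
rewrite -killing_mapE /H_ limg_lfunVK //.
suff ->: limg (killing_map h) = fullv by apply: memvf.
apply/eqP; rewrite eqEdim subvf /= limg_dim_eq ?(eqP killing_map_inj) ?capv0 //.
by rewrite !dimvf /dim /= /dim /= muln1.
Qed.

Lemma cartan_nondegenerate H :
  (forall H1, killing (vsval H1) (vsval H) = 0) -> H = 0.
Proof.
move=> H0; apply/eqP; rewrite -memv0 -(eqP killing_map_inj) memv_ker.
by apply/eqP/lfunP => X; rewrite killing_mapE zero_lfunE.
Qed.

Definition form lam mu : K := lam (H_ mu).

Lemma formE lam mu : form lam mu = killing (vsval (H_ mu)) (vsval (H_ lam)).
Proof. by rewrite /form H_E. Qed.

Lemma formC lam mu : form lam mu = form mu lam.
Proof. by rewrite !formE killingC. Qed.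

Lemma form_linear mu : linear (fun lam => form lam mu : K^o).
Proof. by move=> c u v; rewrite /form add_lfunE scale_lfunE. Qed.

Lemma H_eq0 lam : H_ lam = 0 -> lam = 0.
Proof.
move=> lam0; apply/lfunP => H.
by rewrite H_E lam0 zero_lfunE killing0r.
Qed.

(** B(H, H) is the sum of the squares of the weights at H, and the weights separate
    the points of h. *)
Lemma form_ge0 lam : (forall i, (wt i (H_ lam) : K) \is Num.real) ->
  0 <= form lam lam ?= iff (lam == 0).
Proof.
move=> lam_real; rewrite formE killing_cartan.
have sq_ge0 i : true -> 0 <= (wt i (H_ lam) : K) * wt i (H_ lam).
  by rewrite -expr2 real_exprn_even_ge0.
split; first by rewrite sumr_ge0.
rewrite eq_sym psumr_eq0 //; apply/allP/eqP => [lam0 | -> i _].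
  apply/H_eq0/wt_separates => i; apply/eqP.
  by have := lam0 i (mem_index_enum _); rewrite mulf_eq0 orbb.
by rewrite /H_ !linear0 mulr0 eqxx.
Qed.

(** Both sides lie in h and, by invariance, they have the same product
    alpha(H) B(x, y) with every H in h. *)
Lemma lie_weight_opp alpha x y :
    weight_vector alpha x -> weight_vector (- alpha) y ->
  lie x y = killing x y *: vsval (H_ alpha).
Proof.
move=> wx wy; suff -> : lie x y = vsval (killing x y *: H_ alpha) by rewrite linearZ.
rewrite -(vsprojK (cartan_lie_weight wx wy)); congr (vsval _).
apply/eqP; rewrite -subr_eq0; apply/eqP/cartan_nondegenerate => H.
rewrite linearB /= vsprojK ?(cartan_lie_weight wx wy) // linearZ /=.
rewrite killingC -scaleN1r killingDl !killingZl (killingC (vsval (H_ alpha))) -H_E.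
rewrite killing_invariant (lieC y) wy opp_lfunE scaleNr opprK killingZr.
by rewrite mulN1r mulrN mulrC subrr.
Qed.

Lemma dual_weight_vector alpha x : weight_vector alpha x -> x != 0 ->
  exists2 y, weight_vector (- alpha) y & killing x y != 0.
Proof.
move=> wx x0; have [i xi] : exists i : 'I_n, killing x e`_i != 0.
  apply/existsP; apply: contraNT x0 => /existsPn x0.
  apply/eqP/killing_nondegenerate => y; rewrite (coordE e_basis y) killingC.
  elim/big_rec: _ => [|i z _ z0]; first by rewrite killing0l.
  rewrite killingDl z0 addr0 killingZl killingC.
  by move/negbNE/eqP: (x0 i) => ->; rewrite mulr0.
exists e`_i => //; have := e_wt i; suff -> : wt i = - alpha by [].
apply/eqP; rewrite -addr_eq0 addrC; apply: contraNT xi => /(killing_weight wx).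
by move/(_ _ (e_wt i)) ->.
Qed.

Lemma root_weight alpha : is_root alpha ->
  exists2 x, weight_vector alpha x & x != 0.
Proof. by case=> _ [x x0 wx]; exists x. Qed.

Lemma form_root_neq0 alpha : is_root alpha -> form alpha alpha != 0.
Proof.
case=> alpha0 [x x0 wx]; have [y wy xy] := dual_weight_vector wx x0.
apply: contraNneq alpha0 => form0; apply/eqP/H_eq0/val_inj => /=.
have xyH : lie x y = vsval (killing x y *: H_ alpha).
  by rewrite (lie_weight_opp wx wy) linearZ.
have /eqP : lie x y = 0.
  apply: (lie_opposite_eq0 wx wy); rewrite xyH vsvalK linearZ /=.
  by rewrite -[alpha (H_ alpha)]/(form alpha alpha) form0 scaler0.
by rewrite (lie_weight_opp wx wy) scaler_eq0 (negPf xy) => /eqP.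
Qed.

Lemma tauE lam alpha : lam (tau alpha) = 2%:R * form lam alpha / form alpha alpha.
Proof. by rewrite /tau linearZ /= -formE mulrAC. Qed.

Lemma tau_root alpha : is_root alpha -> alpha (tau alpha) = 2%:R.
Proof. by move=> ra; rewrite tauE mulfK ?form_root_neq0. Qed.

(** By lie_weight_opp, any y of weight - alpha with B(x, y) <> 0 can be rescaled. *)
Lemma root_sl2 alpha x : is_root alpha -> weight_vector alpha x -> x != 0 ->
  exists2 y, weight_vector (- alpha) y & lie x y = vsval (tau alpha).
Proof.
move=> ra wx x0; have [y wy xy] := dual_weight_vector wx x0.
exists ((2%:R / form alpha alpha / killing x y) *: y); first exact: weight_vectorZ.
by rewrite lieZr (lie_weight_opp wx wy) scalerA mulfVK // /tau linearZ /= -formE.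
Qed.

Lemma weight_iter_lie alpha lam x v k :
    weight_vector alpha x -> weight_vector lam v ->
  weight_vector (lam + alpha *+ k) (iter k (lie x) v).
Proof.
move=> wx wv; elim: k => [|k IHk]; first by rewrite mulr0n addr0.
by rewrite mulrSr addrA addrC; apply: weight_vector_lie.
Qed.

(** There are finitely many weights, and the lam + k alpha are distinct. *)
Lemma lie_locally_nilpotent alpha lam x v :
    alpha != 0 -> weight_vector alpha x -> weight_vector lam v -> v != 0 ->
  exists2 m, iter m.+1 (lie x) v = 0
    & forall k, (k <= m)%N -> iter k (lie x) v != 0.
Proof.
move=> alpha0 wx wv v0.
have ex_m : exists m, iter m (lie x) v == 0.
  apply: contrapT => /forallNP no_m.
  have /fin_all_exists[f fP] (k : 'I_n.+1) : exists i, wt i = lam + alpha *+ k.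
    by apply: weight_wt (weight_iter_lie k wx wv) _; apply/negP/no_m.
  have /leq_card : injective f.
    move=> k l fkl; apply/val_inj/eqP; have := fP k; rewrite fkl fP => /addrI/eqP.
    rewrite -!scaler_nat -subr_eq0 -scalerBl scaler_eq0 (negPf alpha0) orbF.
    by rewrite subr_eq0 eqr_nat eq_sym.
  by rewrite !card_ord ltnn.
case: (ex_minnP ex_m) => -[|m] /eqP m0 min_m; first by move: m0 v0 => /= ->; rewrite eqxx.
exists m => // k le_km; apply: contraTneq le_km => /eqP /min_m.
by rewrite -ltnNge.
Qed.

Section Sl2.
Variables (alpha lam : hdual) (x y v : L) (H : subvs_of h).
Hypothesis wy : weight_vector (- alpha) y.
Hypotheses (xyH : lie x y = vsval H) (alphaH : alpha H = 2%:R).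
Hypotheses (wv : weight_vector lam v) (v0 : v != 0) (xv0 : lie x v = 0).

Lemma sl2_raise k : lie x (iter k.+1 (lie y) v) =
  (k.+1%:R * ((lam H : K) - k%:R)) *: iter k (lie y) v.
Proof.
elim: k => [|k IHk] /=; rewrite lie_derivation xyH.
  by rewrite wv xv0 lie0r addr0 subr0 mul1r.
rewrite -/(iter k.+1 _ _) IHk lieZr -iterS (weight_iter_lie k.+1 wy wv).
rewrite -scalerDl; congr (_ *: _).
rewrite add_lfunE mulNrn opp_lfunE lfun_mulrn alphaH -(natr1 k.+1) -(natr1 k).
by move: (lam H : K) (k%:R : K) => c d; ring.
Qed.

(** At the last nonzero iterate, sl2_raise gives (m + 1) (lam(H) - m) = 0. *)
Lemma sl2_highest : exists2 m : nat, lam H = m%:R :> K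
  & forall k, (k <= m)%N -> iter k (lie y) v != 0.
Proof.
have Nalpha0 : - alpha != 0.
  rewrite oppr_eq0; apply/eqP => alpha0; move/eqP: alphaH.
  by rewrite alpha0 zero_lfunE eq_sym pnatr_eq0.
have [m m0 mP] := lie_locally_nilpotent Nalpha0 wy wv v0.
exists m => //; have /eqP := sl2_raise m.
rewrite m0 lie0r eq_sym scaler_eq0 (negPf (mP m _)) // orbF mulf_eq0 pnatr_eq0 /=.
by rewrite subr_eq0 => /eqP.
Qed.

End Sl2.

(** Raise v by x as far as possible, p times say, to a highest vector. It has
    weight beta + p alpha, of value m = beta(H) + 2 p at H, and lowering it by y
    gives nonzero vectors m times, which reaches beta - beta(H) alpha when
    beta(H) >= 0. *)
Lemma sl2_string_half alpha beta x y v H :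
    weight_vector alpha x -> weight_vector (- alpha) y ->
    lie x y = vsval H -> alpha H = 2%:R -> weight_vector beta v -> v != 0 ->
  exists2 z : int, beta H = z%:~R :> K
    & 0 <= z -> exists2 u, weight_vector (beta - alpha *~ z) u & u != 0.
Proof.
move=> wx wy xyH alphaH wv v0.
have alpha0 : alpha != 0.
  apply/eqP => alpha0; move/eqP: alphaH.
  by rewrite alpha0 zero_lfunE eq_sym pnatr_eq0.
have [p xp0 xpP] := lie_locally_nilpotent alpha0 wx wv v0.
have wp := weight_iter_lie p wx wv.
have [m] := sl2_highest wy xyH alphaH wp (xpP p (leqnn p)) xp0.
rewrite add_lfunE lfun_mulrn alphaH => betaH mP.
have betaE : beta H = (m%:Z - (2 * p)%:Z)%:~R :> K.
  apply/eqP; rewrite rmorphB /= -subr_eq opprK -pmulrn -pmulrn mulnC natrM.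
  by rewrite -betaH.
exists (m%:Z - (2 * p)%:Z) => // z_ge0.
have le_2p_m : (2 * p <= m)%N by rewrite -lez_nat -subr_ge0.
exists (iter (m - p) (lie y) (iter p (lie x) v)); last by rewrite mP ?leq_subr.
have -> : beta - alpha *~ (m%:Z - (2 * p)%:Z) = beta + alpha *+ p + (- alpha) *+ (m - p).
  have -> : (m - p = m - 2 * p + p)%N by lia.
  by rewrite subzn // -pmulrn mulrnDr !mulNrn -addrA (addrCA (alpha *+ p)) subrr addr0.
exact: weight_iter_lie.
Qed.

(** When beta takes a negative value at the coroot, sl2_string_half applies to the
    opposite triple (y, x, - tau alpha). *)
Lemma root_integral alpha beta : is_root alpha -> is_root beta ->
  exists2 z : int, beta (tau alpha) = z%:~R :> K & is_root (beta - alpha *~ z).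
Proof.
move=> ra [beta0 [v v0 wv]].
have [x wx x0] := root_weight ra; have [y wy xy] := root_sl2 ra wx x0.
have [z zE z_ge0] := sl2_string_half wx wy xy (tau_root ra) wv v0.
exists z => //; split.
  apply: contraNneq beta0 => /eqP; rewrite subr_eq0 => /eqP betaE.
  rewrite betaE; suff -> : z = 0 by rewrite mulr0z.
  apply/eqP; rewrite -(intr_eq0 K); move/eqP: zE.
  by rewrite betaE lfun_mulrz tau_root // mulr_natr mulr2n -subr_eq0 addrK.
have [/z_ge0[u wu u0] | /ltW z_le0] := lerP 0 z; first by exists u.
have yx : lie y x = vsval (- tau alpha) by rewrite lieC xy linearN.
have wx' : weight_vector (- - alpha) x by rewrite opprK.
have [|z' z'E z'_ge0] := sl2_string_half wy wx' yx _ wv v0.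
  by rewrite opp_lfunE lfunN opprK tau_root.
have z'z : z' = - z.
  by apply: (@intr_inj K); rewrite -z'E lfunN zE mulrNz.
have [|u] := z'_ge0; first by rewrite z'z oppr_ge0.
by rewrite z'z mulrNz mulNrz opprK => wu u0; exists u.
Qed.

(** A vector of weight 2 alpha can be raised to a highest vector w, of weight
    k alpha with k >= 2. Lowering w to the weight alpha gives a vector u with
    [x, u] <> 0, although u must be a multiple of x. *)
Lemma root_double alpha : is_root alpha -> ~ is_root (alpha *+ 2).
Proof.
move=> ra [_ [w0 w00 ww0]].
have [x wx x0] := root_weight ra; have [y wy xy] := root_sl2 ra wx x0.
have alpha0 : alpha != 0 by case: ra.
have [p xp0 xpP] := lie_locally_nilpotent alpha0 wx ww0 w00.
set w := iter p (lie x) w0 in xp0; have w_neq0 : w != 0 by apply: xpP.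
have ww : weight_vector (alpha *+ p.+2) w.
  by rewrite -add2n mulrnDr; apply: weight_iter_lie.
have raise := sl2_raise wy xy (tau_root ra) ww xp0.
have [m mE mP] := sl2_highest wy xy (tau_root ra) ww w_neq0 xp0.
have lamE : (alpha *+ p.+2) (tau alpha) = (2 * p.+2)%:R :> K.
  by rewrite lfun_mulrn tau_root // mulnC natrM.
have m_val : m = (2 * p.+2)%N by apply/eqP; rewrite -(eqr_nat K) -mE lamE.
set u := iter p.+1 (lie y) w.
have wu : weight_vector alpha u.
  have := weight_iter_lie p.+1 wy ww; rewrite mulNrn -mulrnBr // subSnn //.
have u0 : u != 0 by rewrite mP // m_val; lia.
have coef_neq0 k : (k <= p.+1)%N ->
    k.+1%:R * ((alpha *+ p.+2) (tau alpha) - k%:R) != 0 :> K.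
  move=> le_kp; rewrite lamE -natrB; last lia.
  by rewrite mulf_neq0 // pnatr_eq0 -lt0n //; lia.
have : lie x u != 0.
  rewrite raise scaler_eq0 negb_or coef_neq0 //=; apply: mP; rewrite m_val; lia.
(* [x, [y, u]] is a multiple of x, as [y, u] is one of the coroot, and a
   nonzero multiple of u: hence u commutes with x. *)
have xyu : lie x (lie y u) = (killing u y * form alpha alpha) *: x.
  rewrite (lieC y) (lie_weight_opp wu wy) lieNr lieZr lieC scalerN opprK.
  by rewrite wx scalerA.
move: xyu; rewrite -[lie y u]iterS raise => /(congr1 (lie x))/eqP.
rewrite !lieZr liexx scaler0 scaler_eq0 (negPf (coef_neq0 p.+1 (leqnn _))) /=.
by move=> ->.
Qed.

(** * The roots of the simple ideals *)

Definition cartan_component j H : subvs_of h :=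
  vsproj h (component j (vsval H)).

Lemma vsval_cartan_component j H :
  vsval (cartan_component j H) = component j (vsval H).
Proof. by rewrite vsprojK // component_cartan ?subvsP. Qed.

Lemma cartan_component_sum H : \sum_j cartan_component j H = H.
Proof.
apply: val_inj => /=; rewrite -[RHS]component_sum linear_sum /=.
by apply: eq_bigr => j _; rewrite vsval_cartan_component.
Qed.

Lemma p_E j lam H : p_ g_ j lam H = lam (cartan_component j H).
Proof.
rewrite /p_ linear_formE // => c X Y.
by rewrite !linearP.
Qed.

Lemma p_linear j : linear (p_ g_ j : hdual -> hdual).
Proof.
move=> c lam mu; apply/lfunP => H.
by rewrite add_lfunE scale_lfunE !p_E add_lfunE scale_lfunE.
Qed.

Lemma p_in_dual i j lam :
  in_dual g_ j lam -> p_ g_ i lam = if i == j then lam else 0.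
Proof.
move=> lam_j; have lam0 r H : r != j -> lam (cartan_component r H) = 0.
  by move=> rj; apply: (lam_j r); rewrite ?vsval_cartan_component ?component_mem.
apply/lfunP => H; rewrite p_E; case: eqP => [-> | /eqP ij].
  rewrite -[H in RHS]cartan_component_sum linear_sum (bigD1 j) //=.
  by rewrite big1 ?addr0 // => r; apply: lam0.
by rewrite lam0 // zero_lfunE.
Qed.

Lemma in_dual_disjoint i j lam :
  i != j -> in_dual g_ i lam -> in_dual g_ j lam -> lam = 0.
Proof.
move=> ij lam_i lam_j; have := p_in_dual i lam_i.
by rewrite eqxx (p_in_dual i lam_j) (negPf ij) => <-.
Qed.

Lemma in_dualZD j c lam mu : in_dual g_ j lam -> in_dual g_ j mu ->
  in_dual g_ j (c *: lam + mu).
Proof.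
move=> lam_j mu_j r H rj gH.
by rewrite add_lfunE scale_lfunE (lam_j r) // (mu_j r) // scaler0 addr0.
Qed.

Lemma component_weight alpha r x :
  weight_vector alpha x -> weight_vector alpha (component r x).
Proof. by move=> wx H; rewrite -component_lie wx linearZ. Qed.

(** The elements of h in another ideal than g_r act by zero on g_r. *)
Lemma component_weight_in_dual alpha r x :
  weight_vector alpha x -> component r x != 0 -> in_dual g_ r alpha.
Proof.
move=> /(component_weight r) wx x0 i H ir gH; move/eqP: (wx H).
rewrite (g_commute ir gH (component_mem r x)) eq_sym scaler_eq0 (negPf x0) orbF.
by move/eqP.
Qed.

Lemma weight_vector_mem_g j alpha x :
  alpha != 0 -> in_dual g_ j alpha -> weight_vector alpha x -> x \in g_ j.
Proof.
move=> alpha0 alpha_j wx; rewrite -(component_sum x) memv_suml // => r _.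
have [->|rj] := eqVneq r j; first exact: component_mem.
have [->|xr] := eqVneq (component r x) 0; first exact: mem0v.
case/eqP: alpha0; apply: in_dual_disjoint rj _ alpha_j.
exact: component_weight_in_dual wx xr.
Qed.

Lemma root_atP j alpha :
  is_root_at g_ j alpha <-> is_root alpha /\ in_dual g_ j alpha.
Proof.
have root_at_root r beta : is_root_at g_ r beta -> is_root beta.
  case=> beta_r beta0 [x [gx x0] wx]; split=> //; exists x => // H.
  rewrite (lie_component _ gx) -vsval_cartan_component wx.
    by rewrite -p_E (p_in_dual r beta_r) eqxx.
  by rewrite vsval_cartan_component component_mem.
split=> [rj|[ra alpha_j]]; first by split; [apply: root_at_root rj | case: rj].
have [alpha0 [x x0 wx]] := ra; split=> //.
by exists x => //; split=> //; apply: weight_vector_mem_g wx.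
Qed.

Lemma root_component alpha : is_root alpha -> exists j, is_root_at g_ j alpha.
Proof.
move=> ra; have [alpha0 [x x0 wx]] := ra.
have [r xr] : exists r, component r x != 0.
  apply/existsP; apply: contraNT x0 => /existsPn x0.
  by rewrite -(component_sum x) big1 // => i _; apply/eqP/negbNE/x0.
exists r; apply/root_atP; split=> //.
exact: component_weight_in_dual wx xr.
Qed.

Lemma root_at_tau j alpha : is_root_at g_ j alpha -> vsval (tau alpha) \in g_ j.
Proof.
move=> /root_atP[ra alpha_j].
have [x wx x0] := root_weight ra; have [y wy <-] := root_sl2 ra wx x0.
by rewrite g_liel //; apply: weight_vector_mem_g wx => //; case: ra.
Qed.

(** Otherwise gamma + delta would be a root orthogonal to neither gamma nor delta,
    but P puts it on one side or the other. *)
Lemma root_at_lie0 j (P : hdual -> Prop) gamma delta u v :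
    (forall gamma delta, is_root_at g_ j gamma -> is_root_at g_ j delta ->
       P gamma -> ~ P delta -> form gamma delta = 0) ->
    is_root_at g_ j gamma -> is_root_at g_ j delta -> P gamma -> ~ P delta ->
    weight_vector gamma u -> weight_vector delta v ->
  lie u v = 0.
Proof.
move=> P_orth rg rd Pg Pd wu wv; have [uv|uv] := eqVneq (lie u v) 0; first by [].
have wuv := weight_vector_lie wu wv.
have formD lam mu nu : form (lam + mu) nu = form lam nu + form mu nu.
  by have := form_linear nu 1 lam mu; rewrite !scale1r.
have [rg' gamma_j] := (root_atP j gamma).1 rg.
have [rd' delta_j] := (root_atP j delta).1 rd.
have gd0 := P_orth _ _ rg rd Pg Pd.
have sum0 : gamma + delta != 0.
  apply: contra (form_root_neq0 rd') => /eqP gd; have := formD gamma delta delta.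
  by rewrite gd gd0 add0r => <-; rewrite /form zero_lfunE.
have rgd : is_root_at g_ j (gamma + delta).
  apply/root_atP; split; first by split=> //; exists (lie u v).
  by rewrite -[gamma]scale1r; apply: in_dualZD.
have [Pgd | Pgd] := pselect (P (gamma + delta)).
  have /eqP := P_orth _ _ rgd rd Pgd Pd.
  by rewrite formD gd0 add0r (negPf (form_root_neq0 rd')).
have /eqP := P_orth _ _ rg rgd Pg Pgd.
by rewrite formC formD (formC delta) gd0 addr0 (negPf (form_root_neq0 rg')).
Qed.

(** If some roots of g_j were outside P, the centralizer in g_j of their root spaces
    would be an ideal. By root_at_lie0 it contains the root vectors of weight
    gamma0, and it is not g_j since no root vector is central. *)
Lemma root_at_irreducible j (P : hdual -> Prop) gamma0 :
    is_root_at g_ j gamma0 -> P gamma0 ->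
    (forall gamma delta, is_root_at g_ j gamma -> is_root_at g_ j delta ->
       P gamma -> ~ P delta -> form gamma delta = 0) ->
  forall delta, is_root_at g_ j delta -> P delta.
Proof.
move=> rg0 Pg0 P_orth delta rd; apply: contrapT => nPd.
pose Q k := `[< is_root_at g_ j (wt k) /\ ~ P (wt k) >].
pose C := (g_ j :&: \bigcap_(k | Q k) lker (ad e`_k))%VS.
have memC x : reflect (x \in g_ j /\ forall k, Q k -> lie e`_k x = 0) (x \in C).
  rewrite memv_cap memvE; apply: (iffP andP) => -[gx xk]; split=> //.
    move=> k Qk; have /subv_bigcapP/(_ k Qk) := xk.
    by rewrite -memvE memv_ker adE => /eqP.
  by apply/subv_bigcapP => k Qk; rewrite -memvE memv_ker adE xk.
have e_neq0 (k : 'I_n) : e`_k != 0.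
  by apply: (free_not0 (basis_free e_basis)); rewrite mem_nth ?size_tuple.
have e_root k : wt k != 0 -> is_root (wt k).
  by move=> wk; split=> //; exists e`_k; [apply: e_neq0 | apply: e_wt].
have C_ideal : (lie_prod (g_ j) C <= C)%VS.
  apply/lie_prodP => x y gx /memC[gy yk].
  rewrite (coordE e_basis x) lie_suml memv_suml // => i _.
  rewrite lieZl memvZ //; apply/memC; split; first exact: g_lier.
  move=> k Qk; rewrite lie_derivation (yk k Qk) lie0r addr0.
  have [wi | /e_root ri] := eqVneq (wt i) 0.
    have hi : e`_i \in h by apply: weight0_mem; rewrite -wi.
    by rewrite (lieC e`_k) -(vsprojK hi) e_wt lieNl lieZl yk // scaler0 oppr0.
  have [r rr] := root_component ri.
  have /asboolP[rk nPk] := Qk; have [rj | rj] := eqVneq r j; last first.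
    apply: lie_centralizer; first exact: yk.
    apply: (g_commute rj _ gy); have [_ wi_r] := (root_atP r (wt i)).1 rr.
    by apply: weight_vector_mem_g (e_wt i) => //; case: ri.
  rewrite rj in rr; have [Pi | nPi] := pselect (P (wt i)).
    have ik0 := root_at_lie0 P_orth rr rk Pi nPk (e_wt i) (e_wt k).
    by rewrite (lieC e`_k) ik0 oppr0 lie0l.
  by apply: lie_centralizer; apply: yk => //; apply/asboolP.
have [rg0' g0_j] := (root_atP j gamma0).1 rg0; have [g00 [x x0 wx]] := rg0'.
have Cx : x \in C.
  apply/memC; split; first exact: weight_vector_mem_g wx.
  move=> k /asboolP[rk nPk].
  by rewrite lieC (root_at_lie0 P_orth rg0 rk Pg0 nPk wx (e_wt k)) oppr0.
have [rd' d_j] := (root_atP j delta).1 rd; have [d0 [v v0 wv]] := rd'.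
have [i wi] := weight_wt wv v0.
have [_ gI] := g_simple j; have [||C0|Cg] := gI C => //; first exact: capvSl.
  by move: x0; rewrite -memv0 -C0 Cx.
case/eqP: (e_neq0 i); apply: semisimple_center0 => // z.
have gei : e`_i \in g_ j by apply: weight_vector_mem_g (e_wt i) => //; rewrite wi.
rewrite lieC (lie_component _ gei).
have /memC[_ zi] : component j z \in C by rewrite Cg component_mem.
by rewrite lieC zi ?oppr0 //; apply/asboolP; rewrite wi.
Qed.

Lemma formZD c lam mu nu :
  form (c *: lam + mu) nu = c * form lam nu + form mu nu.
Proof. exact: form_linear. Qed.

Lemma root_wt gamma : is_root gamma -> exists i, wt i = gamma.
Proof. by case=> _ [x x0 wx]; apply: weight_wt wx x0. Qed.

Lemma wt_tau_int i gamma :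
  is_root gamma -> exists z : int, wt i (tau gamma) = z%:~R :> K.
Proof.
move=> rg; have [->|wi] := eqVneq (wt i) 0; first by exists 0; rewrite zero_lfunE.
have ri : is_root (wt i).
  split=> //; exists e`_i; last exact: e_wt.
  by apply: (free_not0 (basis_free e_basis)); rewrite mem_nth ?size_tuple.
by have [z zE _] := root_integral rg ri; exists z.
Qed.

(** As the weights take integral values z_i at the coroot of gamma, expanding
    (gamma, gamma) over the weights gives (gamma, gamma) = 4 / sum z_i ^ 2. *)
Lemma form_root_gt0 gamma : is_root gamma -> 0 < form gamma gamma.
Proof.
move=> rg; have f0 := form_root_neq0 rg.
have /fin_all_exists[z zE] (i : 'I_n) := wt_tau_int i rg.
pose S : K := \sum_i (z i)%:~R ^+ 2.
have S_ge0 : 0 <= S.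
  by rewrite sumr_ge0 // => i _; rewrite real_exprn_even_ge0 // rpred_int.
have fS : form gamma gamma * S = 4%:R.
  have wtH i : wt i (H_ gamma) = (z i)%:~R * form gamma gamma / 2%:R :> K.
    by rewrite -zE tauE -/(form _ _); field.
  apply: (mulfI f0); have : form gamma gamma = \sum_i (wt i (H_ gamma) : K) ^+ 2.
    by rewrite {1}formE killing_cartan; apply: eq_bigr => i _; rewrite expr2.
  under eq_bigr => i _ do rewrite wtH.
  have -> : \sum_i ((z i)%:~R * form gamma gamma / 2%:R) ^+ 2 =
            form gamma gamma ^+ 2 / 4%:R * S.
    by rewrite mulr_sumr; apply: eq_bigr => i _; field.
  by move=> fE; rewrite [in RHS]fE; field.
have S_gt0 : 0 < S.
  rewrite lt_neqAle S_ge0 andbT eq_sym; apply/eqP => S0.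
  by move/eqP: fS; rewrite S0 mulr0 eq_sym pnatr_eq0.
by rewrite -(pmulr_lgt0 _ S_gt0) fS ltr0n.
Qed.

Lemma wt_root_real i gamma : is_root gamma -> (wt i (H_ gamma) : K) \is Num.real.
Proof.
move=> rg; have f_gt0 := form_root_gt0 rg; have f0 := lt0r_neq0 f_gt0.
have [z zE] := wt_tau_int i rg.
have -> : wt i (H_ gamma) = z%:~R * form gamma gamma / 2%:R :> K.
  by rewrite -zE tauE -/(form _ _); field.
by rewrite rpred_div ?rpred_nat // rpredM ?rpred_int // gtr0_real.
Qed.

(** The form is positive definite on the vectors with real weights, such as
    v = (gamma, gamma) delta - (gamma, delta) gamma. *)
Lemma root_CauchySchwarz gamma delta : is_root gamma -> is_root delta ->
  form gamma delta ^+ 2 < form gamma gamma * form delta delta \/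
  exists c : K, delta = c *: gamma.
Proof.
move=> rg rd; have gg_gt0 := form_root_gt0 rg; have gg0 := lt0r_neq0 gg_gt0.
set gg := form gamma gamma in gg_gt0 gg0 *; set gd := form gamma delta.
have gd_real : gd \is Num.real.
  by have [i wi] := root_wt rg; rewrite /gd /form -wi wt_root_real.
pose v : hdual := gg *: delta - gd *: gamma.
have v_real i : (wt i (H_ v) : K) \is Num.real.
  have -> : wt i (H_ v) = gg * wt i (H_ delta) - gd * wt i (H_ gamma) :> K.
    by rewrite /H_ /v linearB /= !linearZ /= linearD /= !linearZ /= lfunN scalerN.
  by rewrite rpredB ?rpredM ?wt_root_real // gtr0_real.
have vv : form v v = gg * (gg * form delta delta - gd ^+ 2).
  have fv w : form v w = gg * form delta w - gd * form gamma w.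
    by rewrite /v -scaleNr formZD -[_ *: gamma]addr0 formZD /form zero_lfunE; ring.
  rewrite fv !(formC _ v) !fv (formC delta gamma) -/gg -/gd; ring.
have [v0|v0] := eqVneq v 0.
  right; exists (gd / gg); apply: (scalerI gg0).
  rewrite scalerA mulrCA divff // mulr1; apply/eqP.
  by rewrite -subr_eq0 -/v v0.
left; have [] := form_ge0 v_real; rewrite (negPf v0) => vv_ge0 vv_neq0.
have vv_gt0 : 0 < form v v by rewrite lt_neqAle vv_ge0 vv_neq0.
by move: vv_gt0; rewrite vv pmulr_rgt0 // subr_gt0.
Qed.

Lemma reflectionE gamma lam : reflection gamma lam = reflect_by form gamma lam.
Proof. by rewrite /reflection tauE. Qed.

Lemma root_at_reflect j gamma delta :
  is_root_at g_ j gamma -> is_root_at g_ j delta ->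
  is_root_at g_ j (reflect_by form delta gamma).
Proof.
move=> /root_atP[rg g_j] /root_atP[rd d_j]; apply/root_atP.
have [z zE rz] := root_integral rd rg; rewrite -reflectionE /reflection zE.
split; first by rewrite scaler_int.
by rewrite addrC -scaleNr; apply: in_dualZD.
Qed.

Lemma root_at_double j gamma :
  is_root_at g_ j gamma -> ~ is_root_at g_ j (gamma *+ 2).
Proof. by move=> /root_atP[rg _] /root_atP[r2g _]; apply: root_double r2g. Qed.

Lemma root_at_int j gamma delta :
  is_root_at g_ j gamma -> is_root_at g_ j delta ->
  exists z : int, 2%:R * form gamma delta / form delta delta = z%:~R.
Proof.
move=> /root_atP[rg _] /root_atP[rd _].
by have [z zE _] := root_integral rd rg; exists z; rewrite -tauE.
Qed.

(** * Half roots that are weights *)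

Section Base.
Variable Delta : seq hdual.
Hypothesis Delta_base : is_base Delta.

Definition height lam : K := \sum_i coord (in_tuple Delta) i lam.

Let Delta_basis : basis_of fullv Delta. Proof. by case: Delta_base. Qed.

Lemma height_linear c lam mu : height (c *: lam + mu) = c * height lam + height mu.
Proof.
rewrite /height mulr_sumr -big_split; apply: eq_bigr => i _.
by rewrite linearP.
Qed.

Lemma height_sum (c : 'I_(size Delta) -> nat) :
  height (\sum_(i < size Delta) Delta`_i *+ c i) = (\sum_i c i)%:R.
Proof.
rewrite /height natr_sum; apply: eq_bigr => i _.
under eq_bigr => k _ do rewrite -scaler_nat.
rewrite (coord_sum_free (X := in_tuple Delta) (fun k => (c k)%:R)) //.
exact: basis_free Delta_basis.
Qed.

Lemma height_simple d : d \in Delta -> height d = 1.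
Proof.
move=> Dd; have lt_d : (index d Delta < size Delta)%N by rewrite index_mem.
rewrite /height (bigD1 (Ordinal lt_d)) //= -{2}(nth_index 0 Dd).
rewrite (coord_free (X := in_tuple Delta) (Ordinal lt_d)) ?(basis_free Delta_basis) //.
rewrite eqxx big1 ?addr0 // => i id; rewrite -(nth_index 0 Dd).
rewrite (coord_free (X := in_tuple Delta) (Ordinal lt_d)) ?(basis_free Delta_basis) //.
by rewrite eq_sym (negPf id).
Qed.

Lemma heightN lam : height (- lam) = - height lam.
Proof.
rewrite /height -sumrN; apply: eq_bigr => i _.
by rewrite linearN.
Qed.

Lemma height_root gamma : is_root gamma -> 1 <= height gamma \/ 1 <= - height gamma.
Proof.
move=> rg; have [gamma0 _] := rg; have [_ _ /(_ _ rg)[c cE]] := Delta_base.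
have c_gt0 : (0 < \sum_i c i)%N.
  rewrite lt0n sum_nat_eq0; apply: contra gamma0 => /forallP c0.
  have s0 : \sum_(i < size Delta) Delta`_i *+ c i = 0.
    by rewrite big1 // => i _; move: (c0 i) => /= /eqP ->.
  by case: cE; rewrite s0 ?oppr0 => ->.
by case: cE => ->; rewrite ?heightN ?opprK height_sum ler1n; [left | right].
Qed.

(** p_j fixes the simple roots that lie in Phi_j and kills the other ones. *)
Lemma root_at_span j mu :
    (forall d, d \in Delta /\ is_root_at g_ j d -> form d mu = 0) ->
  forall gamma, is_root_at g_ j gamma -> form gamma mu = 0.
Proof.
move=> Dmu gamma rg; have [rg' g_j] := (root_atP j gamma).1 rg.
have [_ D_root /(_ _ rg')[c cE]] := Delta_base.
pose f lam : K := form (p_ g_ j lam) mu.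
have fD lam nu : f (lam + nu) = f lam + f nu.
  have := p_linear j 1 lam nu; rewrite !scale1r /f => ->.
  by have := formZD 1 (p_ g_ j lam) (p_ g_ j nu) mu; rewrite scale1r mul1r.
have f0 : f 0 = 0 by apply: (addIr (f 0)); rewrite -fD !add0r.
have sum0 : f (\sum_(i < size Delta) Delta`_i *+ c i) = 0.
  rewrite (big_morph f fD f0) big1 // => i _.
  have Dd : Delta`_i \in Delta by rewrite mem_nth.
  have fd : f Delta`_i = 0.
    have [r rr] := root_component (D_root _ Dd); have [_ d_r] := (root_atP r _).1 rr.
    rewrite /f (p_in_dual j d_r); case: eqP => [jr|_]; last by rewrite /form zero_lfunE.
    by apply: Dmu; rewrite jr.
  by elim: (c i) => [|m IHm]; rewrite ?mulr0n // mulrSr fD IHm fd addr0.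
have := p_in_dual j g_j; rewrite eqxx => gE; rewrite -gE -/(f gamma).
case: cE => ->; first exact: sum0.
apply: (addrI (f (\sum_(i < size Delta) Delta`_i *+ c i))).
by rewrite -fD subrr f0 sum0 addr0.
Qed.

Lemma root_at_system j gamma : is_root_at g_ j gamma ->
  irreducible_root_system form (is_root_at g_ j).
Proof.
move=> rg; have root d (rd : is_root_at g_ j d) := proj1 ((root_atP j d).1 rd).
split.
- exact: formC.
- exact: formZD.
- by move=> d /root/form_root_gt0.
- by move=> d1 d2 /root r1 /root r2; apply: root_CauchySchwarz.
- exact: root_at_int.
- exact: root_at_reflect.
- exact: root_at_double.
- exact: root_at_irreducible.
Qed.

(** mu_j is an axis of Phi_j, so the base of Phi_j has type A_1 or C_n and its first
    fundamental weight omega is an axis as well. Distinct axes are exchanged by the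
    reflection in their difference. *)
Lemma half_root_component j beta mu_j :
    is_root_at g_ j beta -> mu_j *+ 2 = beta ->
    (forall gamma, is_root_at g_ j gamma ->
       exists m : int, mu_j (tau gamma) = m%:~R) ->
  (exists a : 1.-tuple hdual,
     base_numbering g_ Delta j cartan_A1 a /\
     exists2 omega1, fundamental_weight g_ j a ord0 omega1
       & mu_j = omega1 \/ mu_j = - omega1) \/
  (exists (n : nat) (a : n.+2.-tuple hdual),
     base_numbering g_ Delta j (cartan_C n.+2) a /\
     exists w omega1,
       [/\ weyl_group_at g_ j w,
           fundamental_weight g_ j a ord0 omega1
         & w mu_j = omega1]).
Proof.
move=> rb mu_beta mu_int; have RS := root_at_system rb.
have ax_mu : axis form (is_root_at g_ j) mu_j.
  split=> [|gamma rg]; first by rewrite mu_beta.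
  by have [z zE] := mu_int _ rg; exists z; rewrite -tauE.
have axis_in_dual omega : axis form (is_root_at g_ j) omega -> in_dual g_ j omega.
  case=> /root_atP[_ w2] _; rewrite (_ : omega = 2%:R^-1 *: (omega *+ 2) + 0).
    by apply: in_dualZD => // r H _ _; rewrite zero_lfunE.
  by rewrite addr0 -scaler_nat scalerA mulVf ?scale1r // pnatr_eq0.
pose D d := d \in Delta /\ is_root_at g_ j d.
have fundamental m (a : m.+1.-tuple hdual) omega :
    simple_system form (is_root_at g_ j) D a omega ->
    fundamental_weight g_ j a ord0 omega.
  by case=> _ _ ax_w wa; split=> [|k]; [apply: axis_in_dual | rewrite tauE wa].
have D_simple d : D d -> is_root_at g_ j d /\ height d = 1.
  by case=> Dd rd; split=> //; apply: height_simple.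
have ht_root gamma : is_root_at g_ j gamma -> 1 <= height gamma \/ 1 <= - height gamma.
  by case/root_atP=> rg _; apply: height_root.
have wt_root gamma : is_root_at g_ j gamma -> gamma \in codom wt.
  by case/root_atP=> /root_wt[i <-] _; apply: codom_f.
have [[a [omega [aS mu_w]]]|[m [a [omega [aS aC]]]]] :=
  simple_system_A1_or_C RS ax_mu height_linear ht_root D_simple (@root_at_span j) wt_root.
- left; exists a; split; last by exists omega => //; apply: fundamental.
  have [a_uniq aD _ _] := aS; split=> // i k.
  rewrite mxE (ord1 i) (ord1 k) tau_root //.
  have /aD[_ /root_atP[]//] : tnth a 0 \in a by apply: mem_tnth.
right; exists m, a; split.
  by have [a_uniq aD _ _] := aS; split=> // i k; rewrite tauE aC.
have [_ _ ax_w _] := aS.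
have [mu_w|mu_w] := eqVneq mu_j omega.
  by exists id, omega; split=> //; [apply: weyl_id | apply: fundamental].
exists (reflection (mu_j - omega) \o id), omega; split; last 2 first.
- exact: fundamental.
- by rewrite /= reflectionE (reflect_exchange RS) //; apply/eqP.
apply: weyl_comp; last exact: weyl_id.
by have [/eqP|] := axes_linked RS ax_mu ax_w; first by rewrite (negPf mu_w).
Qed.

(** If alpha and beta belong to different ideals g_i and g_j, then k alpha vanishes
    at the coroots of g_j, where the weight mu thus agrees with beta / 2. *)
Lemma twice_weight_cases (mu alpha beta : hdual) (k : int) :
    abstract_weight mu -> is_root alpha -> is_root beta ->
    mu *+ 2 = alpha *~ (2 * k) + beta ->
  (exists j : 'I_N,
     [/\ abstract_weight_at g_ j mu, is_root_at g_ j alpha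
       & is_root_at g_ j beta])
  \/
  (exists i j : 'I_N,
     [/\ i != j,
         forall r, r != i -> r != j -> p_ g_ r mu = 0,
         is_root_at g_ i alpha,
         p_ g_ i mu = alpha *~ k
       & (exists a : 1.-tuple hdual,
            base_numbering g_ Delta j cartan_A1 a /\
            exists2 omega1, fundamental_weight g_ j a ord0 omega1
              & p_ g_ j mu = omega1 \/ p_ g_ j mu = - omega1)
         \/
         (exists (n : nat) (a : n.+2.-tuple hdual),
            base_numbering g_ Delta j (cartan_C n.+2) a /\
            exists w omega1,
              [/\ weyl_group_at g_ j w,
                  fundamental_weight g_ j a ord0 omega1
                & w (p_ g_ j mu) = omega1])]).
Proof.
move=> mu_weight ra rb mu_eq.
have [i ri] := root_component ra; have [j rj] := root_component rb.
have [_ alpha_i] := (root_atP i alpha).1 ri; have [_ beta_j] := (root_atP j beta).1 rj.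
pose mu_j := 2%:R^-1 *: beta : hdual.
have mu_j2 : mu_j *+ 2 = beta.
  by rewrite -scaler_nat scalerA divff ?scale1r // pnatr_eq0.
have muE : mu = k%:~R *: alpha + mu_j.
  by apply: double_inj; rewrite mulrnDl mu_j2 mu_eq scaler_int (mulrC 2) mulrzA -pmulrn.
have mu_j_in : in_dual g_ j mu_j.
  rewrite -[mu_j]addr0; apply: in_dualZD => // r H _ _; exact: zero_lfunE.
have [ij|ij] := eqVneq i j.
  left; exists j; rewrite ij in ri alpha_i; split=> //; split.
    by rewrite muE; apply: in_dualZD.
  by move=> gamma /root_atP[rg _]; apply: mu_weight.
have p_mu r : p_ g_ r mu =
    (if r == i then alpha *~ k else 0) + if r == j then mu_j else 0.
  rewrite muE p_linear (p_in_dual r alpha_i) (p_in_dual r mu_j_in).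
  by case: (r == i); rewrite ?scaler0 ?scaler_int.
right; exists i, j; split=> //.
- by move=> r /negPf ri' /negPf rj'; rewrite p_mu ri' rj' addr0.
- by rewrite p_mu eqxx (negPf ij) addr0.
have -> : p_ g_ j mu = mu_j by rewrite p_mu eqxx eq_sym (negPf ij) add0r.
apply: (half_root_component rj mu_j2) => gamma rg.
have [rg' _] := (root_atP j gamma).1 rg.
have [m mE] := mu_weight _ rg'; exists m.
have alpha0 : alpha (tau gamma) = 0.
  by apply: (alpha_i j); [rewrite eq_sym | apply: root_at_tau].
by rewrite -mE muE [RHS]add_lfunE [X in X + _]scale_lfunE alpha0 scaler0 add0r.
Qed.

End Base.

End SemisimpleStructure.

Theorem proposition9p4 (R : realType) (g : lieAlgType R[i])
    (N : nat) (g_ : 'I_N -> {vspace g})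
    (g_semisimple : semisimple g)
    (g_ideal : forall i, is_ideal (g_ i))
    (g_simple : forall i, is_simple (g_ i))
    (g_direct : directv (\sum_i g_ i)%VS)
    (g_sum : (\sum_i g_ i)%VS = fullv)
    (h : {vspace g}) (h_cartan : is_cartan h)
    (Delta : seq (dual h)) (Delta_base : is_base Delta)
    (mu : dual h) (mu_weight : abstract_weight mu)
    (alpha beta : dual h) (alpha_root : is_root alpha) (beta_root : is_root beta)
    (k : int) (k_neq0 : k != 0)
    (mu_eq : mu *+ 2 = alpha *~ (2 * k) + beta) :
  (exists j : 'I_N,
     [/\ abstract_weight_at g_ j mu, is_root_at g_ j alpha
       & is_root_at g_ j beta])
  \/
  (exists i j : 'I_N,
     [/\ i != j,
         forall r, r != i -> r != j -> p_ g_ r mu = 0,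
         is_root_at g_ i alpha,
         p_ g_ i mu = alpha *~ k
       & (exists a : 1.-tuple (dual h),
            base_numbering g_ Delta j cartan_A1 a /\
            exists2 omega1, fundamental_weight g_ j a ord0 omega1
              & p_ g_ j mu = omega1 \/ p_ g_ j mu = - omega1)
         \/
         (exists (n : nat) (a : n.+2.-tuple (dual h)),
            base_numbering g_ Delta j (cartan_C n.+2) a /\
            exists w omega1,
              [/\ weyl_group_at g_ j w,
                  fundamental_weight g_ j a ord0 omega1
                & w (p_ g_ j mu) = omega1])]).
Proof.
have [n [e [wt [e_basis e_wt]]]] := weight_basis h_cartan.
exact: (twice_weight_cases g_semisimple g_ideal g_simple g_direct g_sum
  h_cartan e_basis e_wt Delta_base mu_weight alpha_root beta_root mu_eq).
Qed.
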